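(* Let $\mathcal C$ be a (finite or infinite) collection of distributions over $[0,1]$ and $\delta>0$. (a) If $\mathcal C$ is $\delta$-easy and $\delta$-non-dominant, then every $\mathcal C$-consistent problem instance admits a BIC bandit algorithm, with number of rounds fixed in advance, which almost surely collects at least $N_{TS}$ samples of each arm within $\tilde O(K^3/\delta^4)$ rounds (with $\tilde O$ hiding absolute constants and polylogarithmic factors). (b) If $\mathcal C$ is $\delta$-hard, then there is $c_\delta>0$ depending only on $\delta$ such that for all sufficiently large $K$ some $\mathcal C$-consistent $K$-armed instance has $R_{LB}>\exp(c_\delta K)$. If $\mathcal C$ is finite and $\min_{\mathcal P\in\mathcal C}\sup(\mathcal P)\neq\Phi_{\mathcal C}$, then $\mathcal C$ is either $\delta$-easy or $\delta$-hard for some $\delta>0$.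
   Context: $\sup(\mathcal P)$ is the supremum of the support of $\mathcal P$; $\Phi_{\mathcal C}=\sup_{\mathcal P\in\mathcal C}\mathbb E_{\mu\sim\mathcal P}[\mu]$. $\mathcal C$ is $\delta$-easy if $\inf_{\mathcal P\in\mathcal C}\mathbb E_{\mu\sim\mathcal P}[(\mu-\Phi_{\mathcal C})_+]>\delta$; $\delta$-hard if $\inf_{\mathcal P\in\mathcal C}\Pr_{\mu\sim\mathcal P}[\mu\geq\Phi_{\mathcal C}-\delta]=0$; $\delta$-non-dominant if $\mathbb E[(\mu_j^0-\mu_i)_+]\geq\delta$ for all arms $i,j$ of every $\mathcal C$-consistent instance. A problem instance is $\mathcal C$-consistent if all its priors lie in $\mathcal C$. Incentivized exploration model: mean rewards $\mu_1,\dots,\mu_K\in[0,1]$ drawn independently, $\mu_i\sim\mathcal P_i$; Bernoulli rewards (each arm has an i.i.d. $\{0,1\}$ sample sequence with mean $\mu_i$, revealed one per choice); each round the algorithm recommends $A_t$ and the agent chooses $A'_t$; with $\mathcal E_{t-1}=\{A'_s=A_s\ \forall s<t\}$, the algorithm is BIC if $\mathbb E[\mu_i-\mu_j\mid A_t=i,\mathcal E_{t-1}]\geq0$ for all $t$ and all $i,j$ with $\Pr[A_t=i]>0$. Prior means $\mu_i^0=\mathbb E[\mu_i]$, arms indexed so $\mu_1^0\geq\dots\geq\mu_K^0$. $A^*=\min(\arg\max_j\mu_j)$. $N_{TS}=C_{TS}\varepsilon_{TS}^{-2}\log(\delta_{TS}^{-1})$, $\varepsilon_{TS}=\min_{i,j}\mathbb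 E[(\mu_i-\mu_j)_+]$, $\delta_{TS}=\min_i\Pr[A^*=i]$, $C_{TS}$ a sufficiently large absolute constant. $\Delta_K$: distributions over arms, $\mu_q=\sum_iq_i\mu_i$; $L=\max_{j,q\in\Delta_K}\mathbb E[(\mu_j-\mu_q)_-]/\mathbb E[(\mu_j-\mu_q)_+]$. $\mathrm{ZEROS}_{j,N_0}$: the first $N_0$ samples of every arm $i<j$ are $0$; $N_{boot}=\min\{N_0:\mathbb E[\mu_j-\mu_i\mid\mathrm{ZEROS}_{j,N_0}]>0\ \forall j,\forall i<j\}$; $R_{LB}=\max(K,N_{boot},L)$. *)

(* Defs.v *)
From HB Require Import structures.
From mathcomp Require Import all_boot all_order all_algebra.
From mathcomp Require Import all_classical all_reals all_analysis.
Set Implicit Arguments.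
Unset Strict Implicit.
Unset Printing Implicit Defensive.
Import Order.TTheory GRing.Theory Num.Theory.
Import numFieldNormedType.Exports.
Local Open Scope classical_set_scope.
Local Open Scope ring_scope.

Section IncentivizedExploration.
Variable R : realType.

Definition dist01 (C : set (probability R R)) : Prop :=
  forall P, C P -> P `[(0:R), 1]%classic = 1%E.

Definition Eone (P : probability R R) (f : R -> R) : R :=
  fine (\int[P]_x (f x)%:E)%E.

Definition mean (P : probability R R) : R := Eone P id.

Definition Phi (C : set (probability R R)) : R :=
  fine (ereal_sup [set (mean P)%:E | P in C]).

Definition support (P : probability R R) : set R :=
  [set x : R | forall e : R, 0 < e ->
     let I := [set y : R | x - e < y < x + e] in (0 < P I)%E].
Definition supp_sup (P : probability R R) : R := sup (support P).

Definition min_supp (C : set (probability R R)) : R :=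
  inf [set supp_sup P | P in C].

(** A problem instance with K arms: arms are 0, ..., K-1 and arm i has
    prior P i (values of P at indices >= K are irrelevant). *)
Definition consistent (C : set (probability R R)) (K : nat)
  (P : nat -> probability R R) : Prop :=
  forall i, (i < K)%N -> C (P i).

Definition sorted_inst (K : nat) (P : nat -> probability R R) : Prop :=
  forall i j, (i <= j)%N -> (j < K)%N -> mean (P j) <= mean (P i).

Definition easy (C : set (probability R R)) (d : R) : Prop :=
  (d%:E < ereal_inf [set (Eone P (fun x => Num.max (x - Phi C) 0))%:E | P in C])%E.

Definition hard (C : set (probability R R)) (d : R) : Prop :=
  ereal_inf [set P [set x | Phi C - d <= x] | P in C] = 0%E.

Definition nondominant (C : set (probability R R)) (d : R) : Prop :=
  forall (K : nat) (P : nat -> probability R R), consistent C K P ->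
  forall i j, (i < K)%N -> (j < K)%N ->
    d <= Eone (P i) (fun x => Num.max (mean (P j) - x) 0).

(** Joint law of independent mean rewards mu_0, ..., mu_{K-1}, mu_i ~ P i:
    iterated integral (coordinates >= K are set to 0). *)
Fixpoint iint (n : nat) (P : nat -> probability R R)
  (f : (nat -> R) -> \bar R) : \bar R :=
  match n with
  | 0 => f (fun _ => 0)
  | m.+1 => iint m P (fun mu =>
              (\int[P m]_x f (fun k => if k == m then x else mu k))%E)
  end.

Definition Einst (K : nat) (P : nat -> probability R R) (f : (nat -> R) -> R) : R :=
  fine (iint K P (fun mu => (f mu)%:E)).

(** history: sequence of (recommended = chosen arm, observed Bernoulli reward) *)
Definition history := seq (nat * bool).

Definition valid_alg (K : nat) (alg : history -> nat -> R) : Prop :=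
  (forall h a, 0 <= alg h a) /\
  (forall h a, (K <= a)%N -> alg h a = 0) /\
  (forall h, \sum_(a < K) alg h a = 1).

Definition bern (p : R) (b : bool) : R := if b then p else 1 - p.

Definition hist_prob (alg : history -> nat -> R) (mu : nat -> R) (h : history) : R :=
  \prod_(t < size h)
     (alg (take t h) (nth (0%N, false) h t).1 *
      bern (mu (nth (0%N, false) h t).1) (nth (0%N, false) h t).2).

Fixpoint hists (K T : nat) : seq history :=
  match T with
  | 0 => [:: [::]]
  | T'.+1 => [seq rcons h ab | h <- hists K T',
                ab <- [seq (a, b) | a <- iota 0 K, b <- [:: true; false]]]
  end.

Definition Ejoint (K : nat) (P : nat -> probability R R) (T : nat)
  (alg : history -> nat -> R) (g : (nat -> R) -> history -> R) : R :=
  Einst K P (fun mu => \sum_(h <- hists K T) hist_prob alg mu h * g mu h).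

Definition rec (h : history) (t : nat) : nat := (nth (0%N, false) h t).1.

Definition PrRec K P T alg (t i : nat) : R :=
  Ejoint K P T alg (fun _ h => if rec h t == i then 1 else 0).

Definition condRec K P T alg (t i j : nat) : R :=
  Ejoint K P T alg (fun mu h => if rec h t == i then mu i - mu j else 0)
  / PrRec K P T alg t i.

Definition BIC (K : nat) (P : nat -> probability R R) (T : nat)
  (alg : history -> nat -> R) : Prop :=
  forall t i j, (t < T)%N -> (i < K)%N -> (j < K)%N ->
    0 < PrRec K P T alg t i -> 0 <= condRec K P T alg t i j.

Definition collects (K : nat) (P : nat -> probability R R) (T : nat)
  (alg : history -> nat -> R) (N : R) : Prop :=
  Ejoint K P T alg (fun _ h =>
    if all (fun i => N <= (count (fun ab => ab.1 == i) h)%:R) (iota 0 K)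
    then 1 else 0) = 1.

Definition is_Astar (K : nat) (mu : nat -> R) (i : nat) : Prop :=
  (forall j, (j < K)%N -> mu j <= mu i) /\ (forall j, (j < i)%N -> mu j < mu i).

Definition eps_TS (K : nat) (P : nat -> probability R R) : R :=
  inf [set e | exists i j, [/\ (i < K)%N, (j < K)%N, i <> j &
         e = Einst K P (fun mu => Num.max (mu i - mu j) 0)]].

Definition delta_TS (K : nat) (P : nat -> probability R R) : R :=
  inf [set e | exists i, (i < K)%N /\
         e = Einst K P (fun mu => if `[< is_Astar K mu i >] then 1 else 0)].

Definition N_TS (CTS : R) (K : nat) (P : nat -> probability R R) : R :=
  CTS * (eps_TS K P) ^- 2 * ln ((delta_TS K P)^-1).

Definition simplex (K : nat) (q : nat -> R) : Prop :=
  (forall i, (i < K)%N -> 0 <= q i) /\ \sum_(i < K) q i = 1.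

Definition muq (K : nat) (q mu : nat -> R) : R := \sum_(i < K) q i * mu i.

Definition eratio (a b : R) : \bar R :=
  if 0 < b then (a / b)%:E else if 0 < a then +oo%E else 0%E.

Definition Lval (K : nat) (P : nat -> probability R R) : \bar R :=
  ereal_sup [set r | exists j q, [/\ (j < K)%N, simplex K q &
     r = eratio (Einst K P (fun mu => Num.max (muq K q mu - mu j) 0))
                (Einst K P (fun mu => Num.max (mu j - muq K q mu) 0))]].

(** Pr[ZEROS_{j,N0} | mu] = prod_{i<j} (1 - mu_i)^N0 (i.i.d. Bernoulli samples) *)
Definition zeros_lik (j N0 : nat) (mu : nat -> R) : R :=
  \prod_(0 <= l < j) (1 - mu l) ^+ N0.

Definition condZeros (K : nat) (P : nat -> probability R R) (j N0 i : nat) : R :=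
  Einst K P (fun mu => (mu j - mu i) * zeros_lik j N0 mu)
  / Einst K P (zeros_lik j N0).

(** N_boot (= +oo if no such N0 exists) *)
Definition Nboot (K : nat) (P : nat -> probability R R) : \bar R :=
  ereal_inf [set (N0%:R)%:E | N0 in [set N0 : nat | forall j i,
     (j < K)%N -> (i < j)%N -> 0 < condZeros K P j N0 i]].

Definition RLB (K : nat) (P : nat -> probability R R) : \bar R :=
  maxe (maxe (K%:R)%:E (Nboot K P)) (Lval K P).

End IncentivizedExploration.

(* Main.v *)
(** (a) Arms are explored in decreasing order of prior mean, in stages. The stage of
    arm [j] starts by recommending [j] when the first [n0] samples of every earlier arm
    are zeros (so that [j] has the best posterior mean), and with a tiny probability [kap]
    otherwise. Afterwards [j] is recommended when its own samples look better than [Phi]: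
    since the instance is easy this yields a surplus proportional to the probability of
    having explored [j], and the surplus pays for recommending [j] to a small fraction
    of the runs in which it is still unexplored. Hence the probability of exploration
    grows by a factor [1 + d / 2] per block and reaches 1 after
    [O(log (1 / kap) / d)] blocks. In the growth phase the zeros histories
    are rerandomized so that, given the mean rewards, the probability of recommending
    [j] depends on [mu_j] only; then all the other arms keep their prior means and the
    first arm is a valid alternative recommendation.

    (b) Take [K - 1] arms with prior mean close to [Phi] and one arm whose prior almost
    never reaches [Phi - d]. By Chernoff's bound that last arm beats the average of the
    others with exponentially small probability, so [L] is exponentially large. *)
Require Import Defs.
From HB Require Import structures.
From mathcomp Require Import all_boot all_order all_algebra.
From mathcomp Require Import all_classical all_reals all_analysis.
From mathcomp Require Import measurable_realfun.
From mathcomp Require Import ring lra zify.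
Import Order.TTheory GRing.Theory Num.Theory.
Import numFieldNormedType.Exports.
Local Open Scope classical_set_scope.
Local Open Scope ring_scope.

Set Implicit Arguments.
Unset Strict Implicit.
Unset Printing Implicit Defensive.

(** * Expectations and product laws *)

(** When agents obey, the BIC condition for arm [i] against [j] says that the integral of
    Pr[A_t = i | mu] * (mu_i - mu_j) is nonnegative. Only the law of the recommendation given the
    mean rewards matters, and the algorithm is designed backwards from that law. The obstacle is
    that exploration of arm [j] is correlated with the samples of the earlier arms through the zeros
    event, which would tilt the posteriors of all these arms at once. Letting the zeros runs imitate
    the recommendation probabilities of the other runs cancels this correlation.

    The rate is a product of [K] stages, [M + 1] blocks per stage and [N] rounds per block. Zeros
    become decisive at a length [n0] of order log(1/d)/d, and their effect is then at least
    (d/4)^((n0+1)K), so log(1/kap) is K/d up to logarithms and [M] is K/d^2. Every arm is optimal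
    with probability at least d^K, so the required number of samples, and with it [N], is K/d^2 up
    to logarithms. The product is K^3/d^4. *)

Section BoundedExpectation.
Context (disp : measure_display) (T : measurableType disp) (R : realType).
Variables (Q : probability T R) (A : set T).
Hypotheses (mA : measurable A) (QA : Q A = 1%E).

(** Boundedness is asked only on [A], which carries all the mass: priors are measures on the whole
    line, where even the identity is unbounded. *)
Definition bmeas (f : T -> R) : Prop :=
  measurable_fun setT f /\ exists M, forall x, A x -> `|f x| <= M.

Lemma bmeas_cst c : bmeas (fun=> c).
Proof. by split; [exact: measurable_cst|exists `|c|]. Qed.

Lemma bmeasD f g : bmeas f -> bmeas g -> bmeas (fun x => f x + g x).
Proof.
move=> [mf [M fM]] [mg [N gN]]; split; first exact: measurable_funD.
exists (M + N) => x Ax; rewrite (le_trans (ler_normD _ _))// lerD ?fM ?gN//.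
Qed.

Lemma bmeasM f g : bmeas f -> bmeas g -> bmeas (fun x => f x * g x).
Proof.
move=> [mf [M fM]] [mg [N gN]]; split; first exact: measurable_funM.
exists (M * N) => x Ax; rewrite normrM ler_pM ?fM ?gN//.
Qed.

Lemma bmeasN f : bmeas f -> bmeas (fun x => - f x).
Proof.
move=> [mf [M fM]]; split; first exact: measurableT_comp.
by exists M => x Ax; rewrite normrN fM.
Qed.

Lemma bmeasB f g : bmeas f -> bmeas g -> bmeas (fun x => f x - g x).
Proof. by move=> bf bg; apply: bmeasD => //; exact: bmeasN. Qed.

Lemma bmeasZ c f : bmeas f -> bmeas (fun x => c * f x).
Proof. by move=> bf; apply: bmeasM => //; exact: bmeas_cst. Qed.

Lemma bmeasX f n : bmeas f -> bmeas (fun x => f x ^+ n).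
Proof.
move=> bf; elim: n => [|n IH].
  rewrite [X in bmeas X](_ : _ = fun=> 1); first exact: bmeas_cst.
  by apply/funext => x; rewrite expr0.
rewrite [X in bmeas X](_ : _ = fun x => f x * f x ^+ n); first exact: bmeasM.
by apply/funext => x; rewrite exprS.
Qed.

Lemma bmeas_max f g : bmeas f -> bmeas g -> bmeas (fun x => Num.max (f x) (g x)).
Proof.
move=> [mf [M fM]] [mg [N gN]]; split; first exact: measurable_maxr.
exists (Num.max M N) => x Ax; have := fM _ Ax; have := gN _ Ax.
by move=> gN' fM'; rewrite le_max /Num.max; case: ifP => _; rewrite ?gN' ?fM' ?orbT.
Qed.

Lemma bmeas_sum (I : Type) (s : seq I) (p : pred I) (f : I -> T -> R) :
  (forall i, p i -> bmeas (f i)) -> bmeas (fun x => \sum_(i <- s | p i) f i x).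
Proof.
move=> bf; elim: s => [|i s IH].
  rewrite [X in bmeas X](_ : _ = fun=> 0); first exact: bmeas_cst.
  by apply/funext => x; rewrite big_nil.
rewrite [X in bmeas X](_ : _ = fun x => (if p i then f i x else 0) + \sum_(i <- s | p i) f i x).
  apply: bmeasD => //; case: (boolP (p i)) => pi; first exact: bf.
  exact: bmeas_cst.
by apply/funext => x; rewrite big_cons; case: ifP; rewrite ?add0r.
Qed.

Lemma bmeas_prod (I : Type) (s : seq I) (p : pred I) (f : I -> T -> R) :
  (forall i, p i -> bmeas (f i)) -> bmeas (fun x => \prod_(i <- s | p i) f i x).
Proof.
move=> bf; elim: s => [|i s IH].
  rewrite [X in bmeas X](_ : _ = fun=> 1); first exact: bmeas_cst.
  by apply/funext => x; rewrite big_nil.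
rewrite [X in bmeas X](_ : _ = fun x => (if p i then f i x else 1) * \prod_(i <- s | p i) f i x).
  apply: bmeasM => //; case: (boolP (p i)) => pi; first exact: bf.
  exact: bmeas_cst.
by apply/funext => x; rewrite big_cons; case: ifP; rewrite ?mul1r.
Qed.

Lemma bmeas_ind (b : T -> bool) : measurable [set x | b x] ->
  bmeas (fun x => if b x then 1 else 0).
Proof.
move=> mb; split; last by exists 1 => x _; case: ifP; rewrite ?normr1 ?normr0.
rewrite [X in measurable_fun _ X](_ : _ = \1_[set x | b x]).
  exact: measurable_indic.
apply/funext => x; rewrite indicE; case: ifPn => bx.
  by rewrite mem_set.
by rewrite memNset//; apply/negP.
Qed.

Lemma bmeas_integrable f : bmeas f -> Q.-integrable setT (EFin \o f).
Proof.
move=> [mf [M fM]]; apply/(negligible_integrable (measurableC mA)) => //.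
- exact/measurable_EFinP.
- by rewrite -[LHS]/(Q (~` A)) probability_setC// QA subee.
rewrite setTD setCK; apply: measurable_bounded_integrable => //.
- by rewrite -[X in (X < _)%E]/(Q A) QA ltry.
- exact: measurable_funTS.
exists M; split; first exact: num_real.
by move=> x Mx y Ay; apply: le_trans (fM _ Ay) _; exact: ltW.
Qed.

Definition Exp (f : T -> R) : R := fine (\int[Q]_x (f x)%:E).

Lemma ExpD f g : bmeas f -> bmeas g -> Exp (fun x => f x + g x) = Exp f + Exp g.
Proof.
move=> bf bg; exact: (RintegralD measurableT (bmeas_integrable bf) (bmeas_integrable bg)).
Qed.

Lemma ExpB f g : bmeas f -> bmeas g -> Exp (fun x => f x - g x) = Exp f - Exp g.
Proof.
move=> bf bg; exact: (RintegralB measurableT (bmeas_integrable bf) (bmeas_integrable bg)).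
Qed.

Lemma ExpZ c f : bmeas f -> Exp (fun x => c * f x) = c * Exp f.
Proof.
move=> bf; exact: (RintegralZl c measurableT (bmeas_integrable bf)).
Qed.

Lemma Exp_cst c : Exp (fun=> c) = c.
Proof.
have := @Rintegral_cst _ _ _ Q setT measurableT c.
by rewrite -[X in _ * fine X]/(Q setT) probability_setT mulr1.
Qed.

Lemma Exp_sum (I : Type) (s : seq I) (f : I -> T -> R) :
  (forall i, bmeas (f i)) -> Exp (fun x => \sum_(i <- s) f i x) = \sum_(i <- s) Exp (f i).
Proof.
move=> bf; elim: s => [|i s IH].
  rewrite big_nil -[RHS](Exp_cst 0); congr Exp; apply/funext => x; by rewrite big_nil.
rewrite big_cons -IH -ExpD//; last exact: bmeas_sum.
congr Exp; apply/funext => x; by rewrite big_cons.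
Qed.

(** The complement of [A] is null, so an integrand may be cut off there; this lets [Exp_le] compare
    functions that are ordered only on [A]. *)
Lemma Exp_indicA f : bmeas f -> Exp f = Exp (fun x => f x * \1_A x).
Proof.
move=> bf; congr fine.
have mf : Q.-integrable setT (EFin \o f) by exact: bmeas_integrable.
rewrite -[LHS]/(\int[Q]_x ((EFin \o f) x))%E.
rewrite (@negligible_integral _ _ _ Q setT (~` A))//; last 2 first.
- exact: measurableC.
- by rewrite -[LHS]/(Q (~` A)) probability_setC// QA subee.
rewrite setTD setCK integral_mkcond; apply: eq_integral => x _.
rewrite patchE indicE; case: ifP => xA; first by rewrite mulr1.
by rewrite mulr0.
Qed.

Lemma bmeas_indicA : bmeas \1_A.
Proof.
split; first exact: measurable_indic.
by exists 1 => x _; rewrite indicE; case: (_ \in _); rewrite ?normr1 ?normr0.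
Qed.

Lemma Exp_le f g : bmeas f -> bmeas g -> (forall x, A x -> f x <= g x) ->
  Exp f <= Exp g.
Proof.
move=> bf bg fg; rewrite (Exp_indicA bf) (Exp_indicA bg).
apply: (@le_Rintegral _ _ _ Q setT (fun x => f x * \1_A x) (fun x => g x * \1_A x)).
- exact: measurableT.
- by apply: bmeas_integrable; apply: bmeasM => //; exact: bmeas_indicA.
- by apply: bmeas_integrable; apply: bmeasM => //; exact: bmeas_indicA.
move=> x _; rewrite indicE; case: (boolP (x \in A)) => xA.
  by rewrite !mulr1 fg//; exact: set_mem.
by rewrite !mulr0.
Qed.

Lemma Exp_ge0 f : bmeas f -> (forall x, A x -> 0 <= f x) -> 0 <= Exp f.
Proof.
by move=> bf f0; rewrite -(Exp_cst 0); apply: Exp_le => //; exact: bmeas_cst.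
Qed.

Lemma Exp_ind (b : T -> bool) (B : set T) : measurable B ->
  (forall x, b x <-> B x) -> ((Exp (fun x => if b x then 1 else 0))%:E = Q B)%E.
Proof.
move=> mB bB.
have -> : (fun x : T => if b x then 1 else 0 : R) = \1_B.
  apply/funext => x; rewrite indicE; case: ifPn => bx; first by rewrite mem_set//; exact/bB.
  by rewrite memNset// => /bB; exact/negP.
rewrite /Exp.
have -> : (\int[Q]_x (\1_B x)%:E)%E = Q B by rewrite integral_indic// setIT.
by rewrite fineK// fin_num_measure.
Qed.

End BoundedExpectation.

(** * The joint law of the mean rewards as a probability measure *)

Section ProductLaw.
Context (R : realType).

Definition coord_sets : set (set (nat -> R)) :=
  [set A | exists i (B : set R), measurable B /\ A = (fun mu => mu i) @^-1` B].

Definition seqT := g_sigma_algebraType coord_sets.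

Lemma measurable_coord i : measurable_fun setT (fun mu : seqT => mu i : R).
Proof.
move=> _ B mB; rewrite setTI; apply: sub_sigma_algebra.
by exists i, B.
Qed.

Definition upd_seq (m : nat) (z : seqT * R) : seqT :=
  fun k => if k == m then z.2 else z.1 k.

Lemma measurable_upd m : measurable_fun setT (upd_seq m).
Proof.
apply: (@measurability _ _ _ _ setT (upd_seq m) coord_sets) => //.
move=> _ [_ [i [B [mB ->]]] <-]; rewrite setTI.
have [->|im] := eqVneq i m.
  rewrite [X in measurable X](_ : _ = snd @^-1` B); last first.
    by apply/seteqP; split => z /=; rewrite /upd_seq eqxx.
  by rewrite -[X in measurable X]setTI; exact: measurable_snd.
rewrite [X in measurable X](_ : _ = (fun z : seqT * R => z.1 i) @^-1` B); last first.
  by apply/seteqP; split => z /=; rewrite /upd_seq (negbTE im).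
have h : measurable_fun setT (fun z : seqT * R => z.1 i : R).
  exact: (measurableT_comp (measurable_coord i) measurable_fst).
by rewrite -[X in measurable X]setTI; exact: h.
Qed.

HB.instance Definition _ m :=
  isMeasurableFun.Build _ _ _ _ (upd_seq m) (measurable_upd m).

Variable P : nat -> probability R R.

Fixpoint law (n : nat) : probability seqT R :=
  match n with
  | 0 => @dirac _ seqT (fun=> 0) R
  | m.+1 => distribution (law m \x P m : probability _ R)%E (upd_seq m)
  end.

(** Fubini, one coordinate at a time: [law m.+1] is the image of a product measure under
    [upd_seq m], and [iint] integrates coordinate [m] innermost. *)
Lemma iint_integral n (f : seqT -> \bar R) : (law n).-integrable setT f ->
  iint n P f = (\int[law n]_mu f mu)%E.
Proof.
elim: n f => [|m IH] f intf.
  by rewrite /= integral_dirac ?diracT ?mul1e//; exact: measurable_int intf.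
have mf : measurable_fun setT f := measurable_int _ intf.
have ip : (law m \x P m)%E.-integrable setT (f \o upd_seq m).
  apply/integrableP; split.
    exact: (measurableT_comp mf (measurable_upd m)).
  move/integrableP: intf => [_]; apply: le_lt_trans.
  rewrite [X in (_ <= X)%E](_ : _ = \int[law m \x P m]_z ((abse \o f) \o upd_seq m) z)%E//.
  have e := @ge0_integral_pushforward _ _ _ _ _ (upd_seq m) (measurable_upd m) (law m \x P m)%E setT (abse \o f).
  rewrite preimage_setT in e.
  rewrite -e //; last by move=> y _; exact: abse_ge0.
  have h := measurableT_comp (@abse_measurable R setT) mf. exact h.
have := integral12_prod_meas1 ip.
have iF := integrable_fubini_F ip.
rewrite -(IH _ iF) => E.
rewrite [RHS](_ : _ = \int[law m \x P m]_z (f \o upd_seq m) z)%E.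
  by rewrite -E.
have e := @integral_pushforward _ _ _ _ _ (upd_seq m) (measurable_upd m) (law m \x P m)%E setT f mf.
by rewrite preimage_setT in e; exact: (e ip measurableT).
Qed.


End ProductLaw.

Section Instance.
Context (R : realType).
Local Notation I01 := `[(0:R), 1]%classic.

Definition cube : set (seqT R) := [set mu | forall k, 0 <= mu k <= 1].

Lemma I01P (x : R) : I01 x <-> 0 <= x <= 1.
Proof. by rewrite /= in_itv. Qed.

Lemma measurable_cube : measurable cube.
Proof.
rewrite [X in measurable X](_ : _ = \bigcap_k ((fun mu : seqT R => mu k : R) @^-1` I01)).
  apply: bigcap_measurable => // k _.
  by rewrite -[X in measurable X]setTI; exact: measurable_coord.
by apply/seteqP; split => mu /= h k; [move=> _ /=; rewrite in_itv; exact: h|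
  have := h k I; rewrite /= in_itv].
Qed.

Variables (K : nat) (P : nat -> probability R R).
Hypothesis P01 : forall i, (i < K)%N -> P i I01 = 1%E.

Lemma law_cube n : (n <= K)%N -> law P n cube = 1%E.
Proof.
elim: n => [_|m IH mK].
  by rewrite /= diracE mem_set// => k /=; rewrite lexx ler01.
apply/eqP; rewrite eq_le probability_le1 ?andbT; last exact: measurable_cube.
rewrite /= /distribution /pushforward.
have mp : measurable (cube `*` I01).
  by apply: measurableX; [exact: measurable_cube|exact: measurable_itv].
rewrite (@le_trans _ _ ((law P m \x P m)%E (cube `*` I01)))//.
  have -> : (law P m \x P m)%E (cube `*` I01) = (law P m cube * P m I01)%E.
    by apply: product_measure1E => //; exact: measurable_cube.
  by rewrite IH ?P01 ?mule1// ltnW.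
apply: le_measure.
- by rewrite inE.
- rewrite inE -[X in measurable X]setTI.
  by apply: measurable_upd => //; exact: measurable_cube.
move=> [mu x] [/= cmu]; rewrite in_itv /= => x01 k; rewrite /upd_seq /=.
by case: eqP.
Qed.

Lemma bmeas_coord (f : R -> R) i : bmeas I01 f -> bmeas cube (fun mu : seqT R => f (mu i)).
Proof.
move=> [mf [M fM]]; split; last by exists M => mu /(_ i) ?; apply: fM; apply/I01P.
exact: (measurableT_comp mf (@measurable_coord R i)).
Qed.

Lemma EinstE (f : seqT R -> R) : bmeas cube f -> Einst K P f = Exp (law P K) f.
Proof.
move=> bf; rewrite /Einst /Exp (@iint_integral _ P K (EFin \o f))//.
by apply: (bmeas_integrable measurable_cube (law_cube (leqnn K)) bf).
Qed.

End Instance.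

Section ProductFormula.
Context (R : realType).
Local Notation I01 := `[(0:R), 1]%classic.
Let mI : measurable I01. Proof. exact: measurable_itv. Qed.

(** Independence of the arms: once the first [m] coordinates are fixed, their factors leave the
    innermost integral. *)
Lemma Einst_prod K (P : nat -> probability R R) (f : nat -> R -> R) :
  (forall i, (i < K)%N -> P i I01 = 1%E) ->
  (forall i, (i < K)%N -> bmeas I01 (f i)) ->
  Einst K P (fun mu => \prod_(i < K) f i (mu i)) = \prod_(i < K) Eone (P i) (f i).
Proof.
elim: K => [|m IH] P01 bf; first by rewrite /Einst /= !big_ord0.
have P01' i : (i < m)%N -> P i I01 = 1%E by move=> im; apply: P01; exact: ltnW.
have bf' i : (i < m)%N -> bmeas I01 (f i) by move=> im; apply: bf; exact: ltnW.
have bp : bmeas (@cube R) (fun mu : seqT R => \prod_(i < m) f i (mu i)).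
  by apply: bmeas_prod => i _; apply: bmeas_coord; exact: bf'.
rewrite [RHS]big_ord_recr /= -IH// mulrC.
rewrite (EinstE P01' bp) -(ExpZ (@measurable_cube R) (law_cube P01' (leqnn m)) _ bp).
rewrite -(EinstE P01'); last by apply: bmeasM => //; exact: bmeas_cst.
rewrite /Einst; congr fine => /=; congr iint; apply/funext => mu.
have ifm := bmeas_integrable mI (P01 _ (ltnSn m)) (bf _ (ltnSn m)).
set c := \prod_(i < m) _.
rewrite [LHS](_ : _ = \int[P m]_x (c%:E * (EFin \o f m) x))%E; last first.
  apply: eq_integral => x _; rewrite big_ord_recr /= eqxx /c -EFinM.
  by congr (_ * _)%:E; apply: eq_bigr => i _; rewrite (ltn_eqF (ltn_ord i)).
rewrite (integralZl measurableT ifm) [RHS]EFinM muleC.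
congr (_ * _)%E; rewrite fineK//; exact: integrable_fin_num.
Qed.

End ProductFormula.

(** * Priors and their supports *)

Section Priors.
Context (R : realType).
Local Notation I01 := `[(0:R), 1]%classic.
Let mI : measurable I01. Proof. exact: measurable_itv. Qed.

Lemma bmeas_id : bmeas I01 (@id R).
Proof.
split; first exact: measurable_id.
by exists 1 => x /I01P/andP[x0 x1]; rewrite ger0_norm.
Qed.

Lemma bmeas_pos (c : R) : bmeas I01 (fun x => Num.max (x - c) 0).
Proof.
apply: bmeas_max; last exact: bmeas_cst.
by apply: bmeasB; [exact: bmeas_id|exact: bmeas_cst].
Qed.

Lemma bmeas_neg (c : R) : bmeas I01 (fun x => Num.max (c - x) 0).
Proof.
apply: bmeas_max; last exact: bmeas_cst.
by apply: bmeasB; [exact: bmeas_cst|exact: bmeas_id].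
Qed.

Lemma mean_ge0 (P : probability R R) : P I01 = 1%E -> 0 <= mean P.
Proof.
move=> P1; apply: (Exp_ge0 mI P1 bmeas_id) => x /I01P/andP[]//.
Qed.

Lemma mean_le1 (P : probability R R) : P I01 = 1%E -> mean P <= 1.
Proof.
move=> P1; rewrite -(Exp_cst P 1).
by apply: (Exp_le mI P1 bmeas_id (bmeas_cst _ _)) => x /I01P/andP[].
Qed.

Variable C : set (probability R R).
Hypothesis C01 : dist01 C.

Lemma PhiE : C !=set0 -> ((Phi C)%:E = ereal_sup [set (mean P)%:E | P in C])%E.
Proof.
move=> [P0 CP0]; rewrite /Phi fineK// fin_real//; apply/andP; split.
  apply: (@lt_le_trans _ _ (mean P0)%:E); first exact: ltNyr.
  by apply: ereal_sup_ubound; exists P0.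
apply: (@le_lt_trans _ _ 1%:E); last exact: ltry.
by apply: ge_ereal_sup => _ [P CP <-]; rewrite lee_fin mean_le1//; exact: C01.
Qed.

Lemma mean_le_Phi P : C P -> mean P <= Phi C.
Proof.
move=> CP; rewrite -lee_fin PhiE; last by exists P.
by apply: ereal_sup_ubound; exists P.
Qed.

Lemma Phi_ge0 P : C P -> 0 <= Phi C.
Proof. by move=> CP; apply: le_trans (mean_le_Phi CP); apply: mean_ge0; exact: C01. Qed.

Lemma Phi_approx e : C !=set0 -> 0 < e -> exists2 P, C P & Phi C - e < mean P.
Proof.
move=> C0 e0.
have : ((Phi C - e)%:E < ereal_sup [set (mean P)%:E | P in C])%E.
  by rewrite -PhiE// lte_fin ltrBlDr ltrDl.
move/ereal_sup_gt => [_ [P CP <-]]; rewrite lte_fin => h.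
by exists P.
Qed.

Lemma easyP d P : easy C d -> C P ->
  d < Eone P (fun x => Num.max (x - Phi C) 0).
Proof.
move=> ed CP; rewrite -lte_fin; apply: lt_le_trans ed _.
by apply: ereal_inf_lbound; exists P.
Qed.

Lemma hardP d e : hard C d -> 0 < e ->
  exists2 P, C P & (P [set x | (Phi C - d <= x)%R] < e%:E)%E.
Proof.
move=> hd e0.
have : (ereal_inf [set P [set x | (Phi C - d <= x)%R] | P in C] < e%:E)%E.
  by rewrite (hd : ereal_inf _ = 0%E) lte_fin.
by move/ereal_inf_lt => [_ [P CP <-] h]; exists P.
Qed.

End Priors.

Lemma measurable_open_itv (R : realType) (a b : R) :
  measurable [set y : R | a < y < b].
Proof.
suff -> : [set y : R | a < y < b] = `]a, b[%classic by exact: measurable_itv.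
by apply/seteqP; split => y /=; rewrite in_itv.
Qed.

(** * The support of a prior on [0,1] *)

Section Support.
Context (R : realType) (P : probability R R).
Local Notation I01 := `[(0:R), 1]%classic.
Hypothesis P1 : P I01 = 1%E.

Lemma outside_measure0 (A : set R) : measurable A -> A `&` I01 = set0 -> P A = 0%E.
Proof.
move=> mA AI; apply/eqP; rewrite -measure_le0.
have <- : P (~` I01) = 0%E.
  by rewrite probability_setC ?P1 ?subee//; exact: measurable_itv.
apply: le_measure; rewrite ?inE//; first by apply: measurableC; exact: measurable_itv.
by move=> x Ax Ix; have : (A `&` I01) x by []; rewrite AI.
Qed.

(** The top of the support is the infimum of the [y] with no mass on [y, +oo[. Each of its
    neighbourhoods has mass, since otherwise the massless tails would start lower. *)
Lemma support_top : exists2 t, Defs.support P t & forall y, t < y -> P `[y, +oo[%classic = 0%E.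
Proof.
pose S := [set y : R | P `[y, +oo[%classic = 0%E].
have S2 : S 2.
  apply: outside_measure0 => //; apply/seteqP; split => // x [] /=.
  by rewrite !in_itv /= andbT => x2 /andP[_ x1]; lra.
have S0 : lbound S 0.
  move=> y Sy; rewrite leNgt; apply/negP => y0.
  have : (P I01 <= P `[y, +oo[%classic)%E.
    apply: le_measure; rewrite ?inE//.
    by move=> x /=; rewrite !in_itv /= andbT => /andP[? ?]; lra.
  by rewrite (Sy : P _ = 0%E) P1 lee_fin ler10.
have hS : has_inf S by split; [exists 2|exists 0].
have up y : inf S < y -> S y.
  move=> /(inf_lt (proj1 hS)) [z Sz zy].
  apply/eqP; rewrite -measure_le0 -(Sz : P _ = 0%E).
  apply: le_measure; rewrite ?inE//.
  by move=> x /=; rewrite !in_itv /= !andbT; lra.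
exists (inf S) => // e e0 /=.
set t := inf S.
have nS : P `[t - e / 2, +oo[%classic != 0%E.
  apply/eqP => h; have : t <= t - e / 2 by apply: ge_inf => //; exists 0.
  by lra.
have Sy : S (t + e / 2) by apply: up; rewrite ltrDl; lra.
have mI : measurable [set y : R | t - e < y < t + e].
  exact: measurable_open_itv.
rewrite lt0e measure_ge0 andbT; apply: contraNN nS => /eqP h0.
rewrite -measure_le0.
apply: (@le_trans _ _ (P ([set y : R | t - e < y < t + e] `|` `[t + e / 2, +oo[%classic))).
  apply: le_measure; rewrite ?inE.
  - exact: measurable_itv.
  - by apply: measurableU => //; exact: measurable_itv.
  move=> x /=; rewrite !in_itv /= !andbT => tx.
  have [h|h] := ltP x (t + e / 2); [left|right] => //; apply/andP; split; lra.
set A1 := [set y : R | _] in mI h0 *; set A2 := (X in A1 `|` X).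
have : (P (A1 `|` A2) <= P A1 + P A2)%E by apply: measureU2 => //; exact: measurable_itv.
by rewrite h0 (Sy : P _ = 0%E) adde0.
Qed.

Lemma support_le1 x : Defs.support P x -> x <= 1.
Proof.
move=> sx; rewrite leNgt; apply/negP => x1.
have e0 : 0 < x - 1 by lra.
have := sx _ e0; rewrite /= outside_measure0 ?ltxx//.
  exact: measurable_open_itv.
by apply/seteqP; split => y // [] /= ?; rewrite in_itv /= => ?; lra.
Qed.

Lemma support_ge0 x : Defs.support P x -> 0 <= x.
Proof.
move=> sx; rewrite leNgt; apply/negP => x0.
have e0 : 0 < - x by lra.
have := sx _ e0; rewrite /= outside_measure0 ?ltxx//.
  exact: measurable_open_itv.
by apply/seteqP; split => y // [] /= ?; rewrite in_itv /= => ?; lra.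
Qed.

Lemma has_sup_support : has_sup (Defs.support P).
Proof.
have [t st _] := support_top; split; first by exists t.
by exists 1 => x; exact: support_le1.
Qed.

Lemma supp_sup_tail y : supp_sup P < y -> P `[y, +oo[%classic = 0%E.
Proof.
move=> sy; have [t st th] := support_top; apply: th.
by apply: le_lt_trans sy; apply: ub_le_sup => //; have [] := has_sup_support.
Qed.

Lemma supp_sup_gt y : y < supp_sup P -> 0 < Eone P (fun x => Num.max (x - y) 0).
Proof.
move=> ys; have [x sx yx] := sup_gt (proj1 has_sup_support) ys.
have e0 : 0 < (x - y) / 2 by lra.
have mB : measurable [set z : R | x - (x - y) / 2 < z < x + (x - y) / 2].
  exact: measurable_open_itv.
have /= h := sx _ e0.
have E := @Exp_ind _ _ _ P (fun z => x - (x - y) / 2 < z < x + (x - y) / 2) _ mB (fun z => iff_refl _).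
rewrite -E lte_fin in h.
have mI : measurable I01 by exact: measurable_itv.
have bi := @bmeas_ind _ _ R I01 (fun z => x - (x - y) / 2 < z < x + (x - y) / 2) mB.
apply: (@lt_le_trans _ _ (Exp P (fun z => (x - y) / 2 * (if x - (x - y) / 2 < z < x + (x - y) / 2 then 1 else 0)))).
  by rewrite (ExpZ mI P1 _ bi) mulr_gt0.
apply: (Exp_le mI P1); [exact: bmeasZ|exact: bmeas_pos|].
move=> z _; case: ifPn => [/andP[h1 h2]|_]; last by rewrite mulr0 le_max lexx orbT.
by rewrite mulr1 le_max; apply/orP; left; lra.
Qed.

End Support.

Lemma finite_lower_bound (R : realType) (T : Type) (C : set T) (f : T -> R) :
  finite_set C -> (forall x, C x -> 0 < f x) ->
  exists2 e, 0 < e & forall x, C x -> e <= f x.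
Proof.
move=> fC f0.
have : finite_set (f @` C) by exact: finite_image.
move=> /finite_seqP[s fs].
have : forall x, x \in s -> 0 < x.
  move=> x xs; have : (f @` C) x by rewrite fs.
  by move=> [y Cy <-]; exact: f0.
have : forall x, C x -> f x \in s.
  by move=> x Cx; have : (f @` C) (f x) by [exists x]; rewrite fs.
clear; move=> Cs; elim: s C Cs => [C Cs _|a s IH C Cs s0].
  by exists 1 => // x /Cs.
have [e e0 he] : exists2 e, 0 < e & forall x, (C `&` [set x | f x \in s]) x -> e <= f x.
  apply: IH; first by move=> x [].
  by move=> x xs; apply: s0; rewrite inE xs orbT.
exists (Num.min a e); first by rewrite lt_min e0 s0 ?mem_head.
move=> x Cx; have := Cs _ Cx; rewrite inE ge_min => /predU1P[->|xs]; first by rewrite lexx.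
by rewrite (he x) ?orbT.
Qed.

Lemma easy_or_hard (R : realType) (C : set (probability R R)) :
  dist01 C -> finite_set C -> min_supp C <> Phi C ->
  exists d : R, 0 < d /\ (easy C d \/ hard C d).
Proof.
move=> C01 fC mP.
have [C0|/set0P[P0 CP0]] := eqVneq C set0.
  by exists 1; split => //; left; rewrite /easy C0 image_set0 ereal_inf0 ltry.
have lb : has_lbound [set supp_sup P | P in C].
  exists 0 => _ [P CP <-]; have [t st _] := support_top (C01 _ CP).
  apply: (le_trans (support_ge0 (C01 _ CP) st)).
  by apply: ub_le_sup => //; have [] := has_sup_support (C01 _ CP).
have [lt|gt|//] := ltgtP (min_supp C) (Phi C).
  have [_ [P CP <-] h] : exists2 s, [set supp_sup P | P in C] s & s < Phi C.
    by apply: inf_lt => //; exists (supp_sup P0), P0.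
  (* Half of the distance keeps [Phi C - d] strictly above the support of [P]. *)
  exists ((Phi C - supp_sup P) / 2); split; first lra.
  right; rewrite /hard; apply/eqP; rewrite eq_le; apply/andP; split.
    apply: ereal_inf_lbound; exists P => //.
    rewrite -[RHS](@supp_sup_tail _ P (C01 _ CP) (Phi C - (Phi C - supp_sup P) / 2)); last lra.
    by congr (P _); apply/seteqP; split => x /=; rewrite in_itv /= andbT.
  by apply: le_ereal_inf_tmp => _ [Q CQ <-].
(* Finiteness turns pointwise positivity into a uniform bound, halved below because [easy] is a
   strict inequality. *)
have [e e0 he] : exists2 e, 0 < e & forall P, C P -> e <= Eone P (fun x => Num.max (x - Phi C) 0).
  apply: finite_lower_bound => // P CP; apply: supp_sup_gt; first exact: C01.
  by apply: lt_le_trans gt _; apply: ge_inf => //; exists P.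
exists (e / 2); split; first lra.
left; rewrite /easy; apply: (@lt_le_trans _ _ e%:E); first by rewrite lte_fin; lra.
by apply: le_ereal_inf_tmp => _ [P CP <-]; rewrite lee_fin he.
Qed.

(** * Hard collections *)

Section HardInstances.
Context (R : realType).
Local Notation I01 := `[(0:R), 1]%classic.
Let mI : measurable I01. Proof. exact: measurable_itv. Qed.

Lemma expRN_le (y : R) : 0 <= y -> expR (- y) <= 1 - y + y ^+ 2.
Proof.
move=> y0; rewrite expRN.
have h : 1 + y <= expR y by exact: expR_ge1Dx.
have y1 : 0 < 1 + y by lra.
apply: (@le_trans _ _ (1 + y)^-1); first by rewrite lef_pV2 ?posrE ?expR_gt0.
rewrite -[X in X <= _]mulr1 ler_pdivrMl//.
have -> : (1 + y) * (1 - y + y ^+ 2) = 1 + y ^+ 3 by ring.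
by rewrite lerDl exprn_ge0.
Qed.

Lemma bmeas_expR (l c : R) : bmeas I01 (fun x => expR (l * (c - x))).
Proof.
split.
  apply: measurableT_comp => //; apply: measurable_funM => //.
  by apply: measurable_funB => //; exact: measurable_id.
exists (expR (`|l| * (`|c| + 1))) => x /I01P/andP[x0 x1].
rewrite ger0_norm ?expR_ge0// ler_expR.
apply: le_trans (ler_norm _) _; rewrite normrM ler_wpM2l//.
by apply: le_trans (ler_normB _ _) _; rewrite lerD2l ger0_norm.
Qed.

(** With l = d/4, the quadratic bound on exp(-l x) leaves the exponent -l d + l d/4 + l^2 =
    -d^2/8. *)
Lemma chernoff (P : probability R R) (d phi : R) : P I01 = 1%E -> 0 < d ->
  phi - d / 4 <= mean P ->
  Eone P (fun x => expR (d / 4 * (phi - d - x))) <= expR (- (d ^+ 2 / 8)).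
Proof.
move=> P1 d0 hm; set l := d / 4.
have l0 : 0 < l by rewrite /l; lra.
have b1 : bmeas I01 (fun x : R => 1 + l ^+ 2 - l * x).
  by apply: bmeasB; [exact: bmeas_cst|apply: bmeasZ; exact: bmeas_id].
have h : Eone P (fun x => expR (l * (phi - d - x))) <=
    Exp P (fun x => expR (l * (phi - d)) * (1 + l ^+ 2 - l * x)).
  apply: (Exp_le mI P1 (bmeas_expR _ _)); first exact: bmeasZ.
  move=> x /I01P/andP[x0 x1].
  rewrite [l * (_ - x)]mulrBr expRD ler_wpM2l ?expR_ge0//.
  apply: le_trans (expRN_le _) _; first by rewrite mulr_ge0// ltW.
  rewrite exprMn [1 + _]addrC -!addrA [_ - l * x]addrC !addrA.
  have : l ^+ 2 * x ^+ 2 <= l ^+ 2.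
    by rewrite ler_piMr ?exprn_ge0 ?expr_le1// ltW.
  lra.
apply: le_trans h _.
rewrite (ExpZ mI P1 _ b1) (ExpB mI P1 (bmeas_cst _ _) (bmeasZ _ (bmeas_id R))) Exp_cst.
rewrite (ExpZ mI P1 _ (bmeas_id R)) -/(mean P).
apply: (@le_trans _ _ (expR (l * (phi - d)) * expR (l ^+ 2 - l * mean P))).
  rewrite ler_wpM2l ?expR_ge0// -addrA; exact: expR_ge1Dx.
rewrite -expRD ler_expR /l.
have : d / 4 * (phi - d / 4) <= d / 4 * mean P by rewrite ler_wpM2l//; lra.
have -> : d ^+ 2 = d * d by rewrite expr2.
lra.
Qed.

Variables (C : set (probability R R)) (d : R).
Hypotheses (C01 : dist01 C) (hC : hard C d) (d0 : 0 < d).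

Definition pair_inst (n : nat) (P1 P2 : probability R R) (i : nat) :=
  if (i < n)%N then P1 else P2.

Lemma hard_mean_le (P : probability R R) e : P I01 = 1%E -> 0 <= Phi C - d -> 
  (P [set x | (Phi C - d <= x)%R] < e%:E)%E -> mean P <= Phi C - d + e.
Proof.
move=> P1 h0 he.
have mB : measurable [set x : R | Phi C - d <= x].
  suff -> : [set x : R | Phi C - d <= x] = `[Phi C - d, +oo[%classic by exact: measurable_itv.
  by apply/seteqP; split => x /=; rewrite in_itv /= andbT.
have E := @Exp_ind _ _ _ P (fun z => Phi C - d <= z) _ mB (fun z => iff_refl _).
have bi := @bmeas_ind _ _ R I01 (fun z => Phi C - d <= z) mB.
rewrite -E lte_fin in he.
apply: (@le_trans _ _ (Exp P (fun x => Phi C - d + (if Phi C - d <= x then 1 else 0)))).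
  apply: (Exp_le mI P1 (bmeas_id R)); first by apply: bmeasD => //; exact: bmeas_cst.
  by move=> x /I01P/andP[x0 x1]; case: ifPn => [|]; rewrite -?ltNge; lra.
by rewrite (ExpD mI P1 (bmeas_cst _ _) bi) Exp_cst lerD2l ltW.
Qed.

Lemma hard_large_L : exists K0 : nat, forall K : nat, (K0 <= K)%N ->
  exists P : nat -> probability R R,
    [/\ consistent C K P, sorted_inst K P &
      ((expR (d ^+ 2 / 16 * K%:R))%:E < RLB K P)%E].
Proof.
(* The two extra units give n - 1 > 64/d^3 for K = n + 1, hence d^2/16 * (n - 1) > 4/d, as the final
   comparison of exponentials requires. *)
exists (Num.bound (64 / d ^+ 3)).+2; case=> [//|n] nK.
have n0 : (0 < n)%N by case: n nK.
have nR0 : 0 < n%:R :> R by rewrite ltr0n.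
have nbig : 64 / d ^+ 3 < n%:R - 1.
  have h : 64 / d ^+ 3 < (Num.bound (64 / d ^+ 3))%:R.
    by apply: archi_boundP; rewrite divr_ge0// exprn_ge0// ltW.
  apply: lt_le_trans h _.
  by rewrite lerBrDr natr1 ler_nat.
(* Each entry has one use: 1 forces [Phi C] to be at least [d], d/4 separates the means of [P1] and
   [P2] by d/2, and the exponential matches Chernoff's bound. *)
pose e := Num.min (Num.min 1 (d / 4)) (expR (- (n%:R * (d ^+ 2 / 8)))).
have e0 : 0 < e.
  rewrite !lt_min ltr01 expR_gt0 andbT /=.
  by rewrite divr_gt0.
have [e1 e2 e3] : [/\ e <= 1, e <= d / 4 & e <= expR (- (n%:R * (d ^+ 2 / 8)))].
  by rewrite /e !ge_min !lexx ?orbT.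
have [P2 CP2 hP2] := hardP hC e0.
have [P1 CP1 hP1] : exists2 P, C P & Phi C - d / 4 < mean P.
  by apply: Phi_approx => //; [exists P2|lra].
have P11 := C01 CP1; have P21 := C01 CP2.
have hPhi : 0 <= Phi C - d.
  rewrite leNgt; apply/negP => h.
  suff : (1 <= P2 [set x | (Phi C - d <= x)%R])%E.
    by move=> /le_lt_trans /(_ hP2); rewrite lte_fin; lra.
  rewrite -P21; apply: le_measure; rewrite ?inE//.
    suff -> : [set x : R | Phi C - d <= x] = `[Phi C - d, +oo[%classic by exact: measurable_itv.
    by apply/seteqP; split => x /=; rewrite in_itv /= andbT.
  by move=> x /I01P/andP[x0 _] /=; lra.
pose P := pair_inst n P1 P2.
have CP : consistent C n.+1 P by move=> i _; rewrite /P /pair_inst; case: ifP.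
have PI i : (i < n.+1)%N -> P i I01 = 1%E by move=> /CP/C01.
have m2 : mean P2 <= Phi C - d + e by exact: hard_mean_le.
exists P; split => //.
  move=> i j ij jn; rewrite /P /pair_inst.
  case: ltnP => jn'; first by rewrite (leq_ltn_trans ij jn').
  by case: ifP => // _; lra.
pose q (i : nat) : R := if (i < n)%N then n%:R^-1 else 0.
have qE mu : muq n.+1 q mu = n%:R^-1 * \sum_(i < n) mu i.
  rewrite /muq big_ord_recr /= /q ltnn mul0r addr0 mulr_sumr.
  by apply: eq_bigr => i _; rewrite ltn_ord.
have sq : simplex n.+1 q.
  split=> [i _|]; first by rewrite /q; case: ifP => // _; rewrite invr_ge0 ltW.
  rewrite big_ord_recr /= /q ltnn addr0.
  under eq_bigr => i _ do rewrite ltn_ord.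
  by rewrite sumr_const card_ord -[LHS]mulr_natl mulfV// gt_eqF.
set a := Einst n.+1 P (fun mu => Num.max (muq n.+1 q mu - mu n) 0).
set b := Einst n.+1 P (fun mu => Num.max (mu n - muq n.+1 q mu) 0).
have bc i : bmeas (@cube R) (fun mu : seqT R => mu i).
  exact: (bmeas_coord i (bmeas_id R)).
have bq : bmeas (@cube R) (fun mu : seqT R => muq n.+1 q mu).
  rewrite /muq; apply: bmeas_sum => i _; apply: bmeasZ; exact: bc.
have Ec i : (i < n.+1)%N -> Exp (law P n.+1) (fun mu : seqT R => mu i) = mean (P i).
  move=> iK; rewrite -(EinstE PI (bc i)) /mean.
  have bi k : (k < n.+1)%N -> bmeas I01 (fun x : R => if k == i then x else 1).
    by move=> _; case: eqP => _; [exact: bmeas_id|exact: bmeas_cst].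
  have := Einst_prod PI bi.
  rewrite [RHS](bigD1 (Ordinal iK)) //= eqxx big1 => [|k ki]; last first.
    by rewrite -(inj_eq val_inj)/= in ki; rewrite (negbTE ki); exact: (Exp_cst (P k) 1).
  rewrite mulr1 => <-.
  congr Einst; apply/funext => mu; rewrite (bigD1 (Ordinal iK)) //= eqxx big1 ?mulr1// => k ki.
  by rewrite -(inj_eq val_inj)/= in ki; rewrite (negbTE ki).
have mC := @measurable_cube R; have LC := law_cube PI (leqnn n.+1).
have ha : d / 2 <= a.
  rewrite /a (EinstE PI); last by apply: bmeas_max; [exact: bmeasB|exact: bmeas_cst].
  apply: (@le_trans _ _ (Exp (law P n.+1) (fun mu : seqT R => muq n.+1 q mu - mu n))).
    rewrite (ExpB mC LC bq (bc n)) Ec// /P /pair_inst ltnn.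
    have -> : Exp (law P n.+1) (fun mu : seqT R => muq n.+1 q mu) = mean P1.
      rewrite /muq (Exp_sum mC LC); last by move=> i; apply: bmeasZ; exact: bc.
      transitivity (\sum_(i < n.+1) q i * mean P1); last by rewrite -mulr_suml sq.2 mul1r.
      apply: eq_bigr => i _; rewrite (ExpZ mC LC _ (bc i)) Ec// /q /P /pair_inst.
      by case: ifP => _; rewrite ?mul0r.
    lra.
  apply: (Exp_le mC LC); [exact: bmeasB|apply: bmeas_max; [exact: bmeasB|exact: bmeas_cst]|].
  by move=> mu _; rewrite le_max lexx.
have hb : b <= 2 * expR (- (n%:R * (d ^+ 2 / 8))).
  have mB : measurable [set x : R | Phi C - d <= x].
    suff -> : [set x : R | Phi C - d <= x] = `[Phi C - d, +oo[%classic by exact: measurable_itv.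
    by apply/seteqP; split => x /=; rewrite in_itv /= andbT.
  have bi := @bmeas_ind _ _ R I01 (fun z => Phi C - d <= z) mB.
  have E := @Exp_ind _ _ _ P2 (fun z => Phi C - d <= z) _ mB (fun z => iff_refl _).
  rewrite -E lte_fin in hP2.
  pose f1 (k : nat) (x : R) : R := if k == n then (if Phi C - d <= x then 1 else 0) else 1.
  pose f2 (k : nat) (x : R) : R := if (k < n)%N then expR (d / 4 * (Phi C - d - x)) else 1.
  have bf1 k : bmeas I01 (f1 k).
    by rewrite /f1; case: eqP => _ //; exact: bmeas_cst.
  have bf2 k : bmeas I01 (f2 k).
    by rewrite /f2; case: (k < n)%N; [exact: bmeas_expR|exact: bmeas_cst].
  have bp1 : bmeas (@cube R) (fun mu : seqT R => \prod_(i < n.+1) f1 i (mu i)).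
    by apply: bmeas_prod => i _; exact: bmeas_coord.
  have bp2 : bmeas (@cube R) (fun mu : seqT R => \prod_(i < n.+1) f2 i (mu i)).
    by apply: bmeas_prod => i _; exact: bmeas_coord.
  (* On the cube the positive part is at most 1, and it vanishes unless [mu n] reaches [Phi C - d]
     or the average falls below that level. The exponential product dominates the indicator of the
     second event. *)
  apply: (@le_trans _ _ (Exp (law P n.+1) (fun mu : seqT R =>
     \prod_(i < n.+1) f1 i (mu i) + \prod_(i < n.+1) f2 i (mu i)))).
    rewrite /b (EinstE PI); last by apply: bmeas_max; [exact: bmeasB|exact: bmeas_cst].
    apply: (Exp_le mC LC); [apply: bmeas_max; [exact: bmeasB|exact: bmeas_cst]|exact: bmeasD|].
    move=> mu cmu; rewrite !big_ord_recr /= big1 => [|i _]; last by rewrite /f1 ltn_eqF.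
    rewrite /f1 eqxx {2}/f2 ltnn mulr1.
    have -> : \prod_(i < n) f2 i (mu i) = expR (d / 4 * (n%:R * (Phi C - d - muq n.+1 q mu))).
      rewrite qE [n%:R * _]mulrBr mulrA mulfV ?gt_eqF// mul1r.
      have -> : n%:R * (Phi C - d) = \sum_(i < n) (Phi C - d).
        by rewrite sumr_const card_ord mulr_natl.
      rewrite -sumrB mulr_sumr expR_sum; apply: eq_bigr => i _.
      by rewrite /f2 ltn_ord.
    rewrite mul1r.
    have q0 : 0 <= muq n.+1 q mu.
      rewrite qE; apply: mulr_ge0; first by rewrite invr_ge0 ltW.
      by apply: sumr_ge0 => i _; have /andP[] := cmu i.
    have /andP[mn0 mn1] := cmu n.
    have ge0 : 0 <= expR (d / 4 * (n%:R * (Phi C - d - muq n.+1 q mu))) by exact: expR_ge0.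
    rewrite ge_max; apply/andP; split; last by case: ifP => _; lra.
    case: ifPn => [_|]; first lra.
    rewrite -ltNge => lt.
    have [//|qm] := leP (mu n - muq n.+1 q mu) 0; first lra.
    suff : 1 <= expR (d / 4 * (n%:R * (Phi C - d - muq n.+1 q mu))) by lra.
    rewrite -[X in X <= _]expR0 ler_expR; apply: mulr_ge0; first by rewrite divr_ge0// ltW.
    by apply: mulr_ge0; [exact: ler0n|lra].
  rewrite (ExpD mC LC bp1 bp2) -(EinstE PI bp1) -(EinstE PI bp2).
  rewrite (@Einst_prod R n.+1 P f1 PI)// (@Einst_prod R n.+1 P f2 PI)//.
  rewrite !big_ord_recr /=.
  rewrite big1 => [|i _]; last first.
    rewrite /P /pair_inst ltn_ord /f1 ltn_eqF//; exact: (Exp_cst P1 1).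
  rewrite mul1r.
  have h1 : Eone (P n) (f1 n) <= e by rewrite /P /pair_inst ltnn /f1 eqxx; exact: ltW.
  apply: (@le_trans _ _ (e + expR (- (n%:R * (d ^+ 2 / 8))))); last by lra.
  apply: lerD => //; rewrite /P /pair_inst ltnn {2}/f2 ltnn.
  rewrite [X in _ * X](Exp_cst P2 1) mulr1.
  have -> : - (n%:R * (d ^+ 2 / 8)) = \sum_(i < n) - (d ^+ 2 / 8).
    by rewrite sumrN sumr_const card_ord mulr_natl.
  rewrite expR_sum; apply: ler_prod => i _; rewrite ltn_ord /f2 ltn_ord.
  apply/andP; split.
    by apply: (Exp_ge0 mI P11 (bmeas_expR _ _)) => x _; exact: expR_ge0.
  by apply: chernoff => //; lra.
apply: (@lt_le_trans _ _ (Lval n.+1 P)); last by rewrite /RLB le_max lexx orbT.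
apply: (@lt_le_trans _ _ (eratio a b)); last first.
  by apply: ereal_sup_ubound; exists n, q; split.
(* If [b] vanishes the ratio is +oo, because [a] is positive. *)
rewrite /eratio; case: ifPn => b0; last by rewrite ifT ?ltry//; lra.
rewrite lte_fin ltr_pdivlMr//; apply: lt_le_trans ha.
apply: le_lt_trans (_ : expR (d ^+ 2 / 16 * n.+1%:R) * (2 * expR (- (n%:R * (d ^+ 2 / 8)))) < _).
  by rewrite ler_wpM2l ?expR_ge0.
rewrite mulrCA -expRD.
have -> : d ^+ 2 / 16 * n.+1%:R + - (n%:R * (d ^+ 2 / 8)) = - (d ^+ 2 / 16 * (n%:R - 1)).
  by rewrite -natr1; field.
have h4 : 4 / d < d ^+ 2 / 16 * (n%:R - 1).
  have -> : 4 / d = d ^+ 2 / 16 * (64 / d ^+ 3) by field; rewrite gt_eqF.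
  by rewrite ltr_pM2l// divr_gt0// exprn_gt0.
rewrite expRN -ltr_pdivlMl// -[X in _ < X]invrK ltf_pV2 ?posrE ?expR_gt0 ?invr_gt0 ?mulr_gt0 ?invr_gt0//.
have -> : (2^-1 * (d / 2))^-1 = 4 / d by field; rewrite gt_eqF.
by apply: lt_trans h4 _; apply: lt_le_trans (expR_ge1Dx _); rewrite ltrDr.
Qed.

End HardInstances.

(** * Bandit algorithms that play in blocks *)

Section BernoulliVectors.
Context (R : realType).
Local Notation I01 := `[(0:R), 1]%classic.

(** Expectation over [n] independent Bernoulli bits of mean [m]. The last bit is integrated
    innermost because histories grow at their end. *)
Fixpoint bern_exp (n : nat) (m : R) (phi : seq bool -> R) : R :=
  if n is n'.+1 then
    bern_exp n' m (fun r => m * phi (rcons r true) + (1 - m) * phi (rcons r false))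
  else phi [::].

Lemma bern_expS n m phi : bern_exp n.+1 m phi =
  bern_exp n m (fun r => m * phi (rcons r true) + (1 - m) * phi (rcons r false)).
Proof. by []. Qed.

Lemma bern_exp_ext n m phi psi : (forall r, size r = n -> phi r = psi r) ->
  bern_exp n m phi = bern_exp n m psi.
Proof.
elim: n phi psi => [|n IH] phi psi h /=; first exact: h.
by apply: IH => r rn; rewrite !h ?size_rcons ?rn.
Qed.

Lemma bern_expD n m phi psi : bern_exp n m (fun r => phi r + psi r) = bern_exp n m phi + bern_exp n m psi.
Proof.
elim: n phi psi => [//|n IH] phi psi /=; rewrite -IH.
by apply: bern_exp_ext => r _; ring.
Qed.

Lemma bern_expZ n m c phi : bern_exp n m (fun r => c * phi r) = c * bern_exp n m phi.
Proof.
elim: n phi => [//|n IH] phi /=; rewrite -IH.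
by apply: bern_exp_ext => r _; ring.
Qed.

Lemma bern_exp_cst n m c : bern_exp n m (fun=> c) = c.
Proof.
elim: n => [//|n IH] /=; rewrite -[RHS]IH.
by apply: bern_exp_ext => r _; ring.
Qed.

Lemma bern_exp_le n m phi psi : 0 <= m <= 1 ->
  (forall r, size r = n -> phi r <= psi r) -> bern_exp n m phi <= bern_exp n m psi.
Proof.
move=> m01; have /andP[m0 m1] := m01.
elim: n phi psi => [|n IH] phi psi h /=; first exact: h.
apply: IH => r rn; apply: lerD; apply: ler_wpM2l; rewrite ?subr_ge0//;
  by apply: h; rewrite size_rcons rn.
Qed.

Lemma bmeas_bern_exp n phi : bmeas I01 (fun m => bern_exp n m phi).
Proof.
have bo : bmeas I01 (fun x : R => 1 - x).
  by apply: bmeasB; [exact: bmeas_cst|exact: bmeas_id].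
suff h : forall (ps : seq bool -> R -> R), (forall r, bmeas I01 (ps r)) ->
    bmeas I01 (fun m => bern_exp n m (fun r => ps r m)).
  by apply: (h (fun r _ => phi r)) => r; exact: bmeas_cst.
elim: n => [|n IH] ps bps /=; first exact: bps.
apply: (IH (fun r m => m * ps (rcons r true) m + (1 - m) * ps (rcons r false) m)) => r.
by apply: bmeasD; apply: bmeasM => //; exact: bmeas_id.
Qed.

Lemma bern_exp_zeros n n0 m : (n0 <= n)%N ->
  bern_exp n m (fun r => (all negb (take n0 r))%:R) = (1 - m) ^+ n0.
Proof.
elim: n n0 => [|n IH] n0; first by rewrite leqn0 => /eqP ->; rewrite expr0.
rewrite leq_eqVlt => /predU1P[->|n0n] /=.
  rewrite exprSr -(IH n)// mulrC -bern_expZ.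
  apply: bern_exp_ext => r rn; rewrite !take_oversize ?size_rcons ?rn//.
  by rewrite !all_rcons /=; ring.
rewrite -IH; last by [].
apply: bern_exp_ext => r rn; rewrite -!cats1 !takel_cat ?rn//; last first.
by ring.
Qed.

Lemma bern_exp_var n m :
  bern_exp n m (fun r => ((count id r)%:R - n%:R * m) ^+ 2) = n%:R * (m * (1 - m)).
Proof.
elim: n => [|n IH] /=; first by rewrite !mul0r subrr expr0n.
transitivity (bern_exp n m (fun r => ((count id r)%:R - n%:R * m) ^+ 2 + m * (1 - m))).
  apply: bern_exp_ext => r _; rewrite -!cats1 !count_cat /= !natrD -natr1; ring.
by rewrite bern_expD IH bern_exp_cst -natr1; ring.
Qed.

End BernoulliVectors.

(** * Expectations over histories for fixed mean rewards *)

Section Histories.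
Context (R : realType).
Variables (K : nat) (alg : history -> nat -> R) (mu : nat -> R).

Definition hist_exp (T : nat) (F : history -> R) : R :=
  \sum_(h <- hists K T) hist_prob alg mu h * F h.

Lemma size_hists T h : h \in hists K T -> size h = T.
Proof.
elim: T h => [|T IH] h /=; first by rewrite inE => /eqP ->.
by move=> /allpairsP[[h' ab] /= [/IH h'T _ ->]]; rewrite size_rcons h'T.
Qed.

Lemma hist_exp_ext T F G : (forall h, size h = T -> F h = G h) -> hist_exp T F = hist_exp T G.
Proof.
move=> FG; rewrite /hist_exp big_seq [RHS]big_seq; apply: eq_bigr => h hT.
by rewrite FG//; exact: size_hists.
Qed.

Lemma hist_prob_rcons h ab :
  hist_prob alg mu (rcons h ab) = hist_prob alg mu h * (alg h ab.1 * bern (mu ab.1) ab.2).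
Proof.
rewrite /hist_prob size_rcons big_ord_recr /=; congr (_ * _).
  apply: eq_bigr => t _; rewrite nth_rcons ltn_ord.
  by rewrite -cats1 takel_cat// ltnW.
by rewrite -cats1 take_size_cat// nth_cat ltnn subnn.
Qed.

Lemma hist_expS T F : hist_exp T.+1 F = hist_exp T (fun h => \sum_(a < K) alg h a *
  (mu a * F (rcons h (nat_of_ord a, true)) + (1 - mu a) * F (rcons h (nat_of_ord a, false)))).
Proof.
rewrite /hist_exp; have -> : hists K T.+1 = [seq rcons h ab | h <- hists K T,
  ab <- [seq (a, b) | a <- iota 0 K, b <- [:: true; false]]] by [].
rewrite big_allpairs_dep; apply: eq_bigr => h _.
rewrite big_allpairs mulr_sumr -[K in iota 0 K]subn0 -/(index_iota 0 K) big_mkord.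
apply: eq_bigr => a _; rewrite !big_cons big_nil !hist_prob_rcons /= /bern.
by ring.
Qed.

Hypothesis alg1 : forall h, \sum_(a < K) alg h a = 1.

(** Later rounds have total mass one and integrate out, so the law of a round does not depend on the
    horizon. *)
Lemma hist_exp_take T t F : (t <= T)%N -> hist_exp T (fun h => F (take t h)) = hist_exp t F.
Proof.
elim: T => [|T IH]; first by rewrite leqn0 => /eqP ->; apply: hist_exp_ext => h; case: h.
rewrite leq_eqVlt => /predU1P[->|tT].
  by apply: hist_exp_ext => h hT; rewrite -hT take_size.
rewrite hist_expS -IH//; apply: hist_exp_ext => h hT.
under eq_bigr => a _.
  rewrite -!cats1 !takel_cat ?hT// -mulrDl addrC subrK mul1r.
  over.
by rewrite -mulr_suml alg1 mul1r.
Qed.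

End Histories.

(** * From histories to a Markov chain on the first samples of each arm *)

Section BlockAlgorithms.
Context (R : realType).
Variables (K N : nat) (slaw : nat -> (nat -> seq bool) -> nat -> R).
Hypothesis N0 : (0 < N)%N.

Definition obs (h : history) (a : nat) : seq bool :=
  [seq ab.2 | ab <- h & ab.1 == a].

Definition first_obs (h : history) (a : nat) : seq bool := take N (obs h a).

Definition hlaw (h : history) (a : nat) : R :=
  slaw (size h %/ N)%N (first_obs h) a.

(* Within a block of N rounds the arm of the first round is repeated; the
   truncation at K.-1 only matters for unreachable histories. *)
Definition block_alg (h : history) (a : nat) : R :=
  if (N %| size h)%N then hlaw h a
  else (a == minn (last (0%N, false) h).1 K.-1)%:R.

(** Only the first block of an arm is recorded; playing it again leaves the state unchanged. *)
Definition upd (x : nat -> seq bool) (a : nat) (r : seq bool) : nat -> seq bool :=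
  fun a' => if (a' == a) && (x a' == [::]) then r else x a'.

Variable mu : nat -> R.

Fixpoint block_exp (b : nat) (G : history -> R) : R :=
  if b is b'.+1 then
    block_exp b' (fun h => \sum_(a < K) hlaw h a *
      bern_exp N (mu a) (fun r => G (h ++ [seq (nat_of_ord a, y) | y <- r])))
  else G [::].

(** The process of [block_exp] seen through a Markov chain whose state holds the first block of
    samples of each arm. *)
Fixpoint state_exp (b : nat) (F : (nat -> seq bool) -> R) : R :=
  if b is b'.+1 then
    state_exp b' (fun x => \sum_(a < K) slaw b' x a *
      bern_exp N (mu a) (fun r => F (upd x a r)))
  else F (fun=> [::]).

Local Notation Eb := (hist_exp K block_alg mu).

Let min_ord (a : 'I_K) : minn a K.-1 = a.
Proof. by have := ltn_ord a; lia. Qed.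

(** Only the first round of a block chooses an arm at random, so the rounds of a block contribute
    independent bits of a single arm. *)
Lemma hist_exp_block b t F : (t < N)%N ->
  Eb (N * b + t.+1) F = Eb (N * b) (fun h => \sum_(a < K) hlaw h a *
    bern_exp t.+1 (mu a) (fun r => F (h ++ [seq (nat_of_ord a, y) | y <- r]))).
Proof.
elim: t F => [|t IH] F tN.
  rewrite addn1 hist_expS; apply: hist_exp_ext => h hT; apply: eq_bigr => a _; rewrite /=.
  by rewrite /block_alg hT dvdn_mulr// !cats1.
rewrite addnS hist_expS IH; last exact: ltnW.
apply: hist_exp_ext => h hT; apply: eq_bigr => a _; congr (_ * _).
rewrite [RHS]bern_expS; apply: bern_exp_ext => r rt.
rewrite (bigD1 a) //= big1 ?addr0 => [|a' aa'].
  rewrite /block_alg size_cat size_map hT rt dvdn_addr ?dvdn_mulr//.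
  rewrite gtnNdvd//.
  case/lastP: r rt => [//|r y] _.
  rewrite map_rcons -rcons_cat last_rcons /= min_ord eqxx mul1r.
  by rewrite !map_rcons -!rcons_cat.
rewrite /block_alg size_cat size_map hT rt dvdn_addr ?dvdn_mulr//.
rewrite gtnNdvd//.
case/lastP: r rt => [//|r y] _.
rewrite map_rcons -rcons_cat last_rcons /= min_ord.
by rewrite (inj_eq val_inj) (negbTE aa') mul0r.
Qed.

Lemma hist_block_exp b G : Eb (N * b) G = block_exp b G.
Proof.
elim: b G => [|b IH] G.
  by rewrite muln0 /hist_exp /= big_seq1 /hist_prob big_ord0 mul1r.
rewrite /= -IH mulnS addnC; have := @hist_exp_block b N.-1 G.
by rewrite !prednK//; apply.
Qed.

(* [S b] is any family of histories that contains all the histories of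
   positive probability after b blocks. *)
Lemma block_exp_ext (S : nat -> history -> Prop) : S 0%N [::] ->
  (forall b h a r, S b h -> (a < K)%N -> hlaw h a != 0 -> size r = N ->
     S b.+1 (h ++ [seq (a, y) | y <- r])) ->
  forall b F G, (forall h, S b h -> F h = G h) -> block_exp b F = block_exp b G.
Proof.
move=> S0 SS_; elim=> [|b IH] F G FG /=; first exact: FG.
apply: IH => h Sh; apply: eq_bigr => a _.
have [->|ha] := eqVneq (hlaw h a) 0; first by rewrite !mul0r.
congr (_ * _); apply: bern_exp_ext => r rN; apply: FG; exact: SS_.
Qed.

(** An arm has no sample or at least a full block, so a new block either becomes the recorded one or
    is cut off by the truncation to [N]. *)
Definition sized (b : nat) (h : history) : Prop :=
  size h = (N * b)%N /\ forall a, obs h a = [::] \/ (N <= size (obs h a))%N.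

Lemma obs_block h a r a' : obs (h ++ [seq (a, y) | y <- r]) a' =
  obs h a' ++ (if a' == a then r else [::]).
Proof.
rewrite /obs filter_cat map_cat; congr (_ ++ _).
rewrite filter_map -map_comp; case: (eqVneq a' a) => [->|aa'].
  rewrite (@eq_filter _ _ predT); last by move=> y /=; rewrite eqxx.
  by rewrite filter_predT map_id.
rewrite (@eq_filter _ _ pred0); first by rewrite filter_pred0.
by move=> y /=; rewrite eq_sym (negbTE aa').
Qed.

Lemma sized0 : sized 0 [::].
Proof. by split=> [|a]; [rewrite muln0|left]. Qed.

Lemma sizedS b h a r : sized b h -> size r = N ->
  sized b.+1 (h ++ [seq (a, y) | y <- r]).
Proof.
move=> [hb ho] rN; split; first by rewrite size_cat size_map hb rN mulnS addnC.
move=> a'; rewrite obs_block; case: eqP => [->|_]; last by rewrite cats0.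
by right; rewrite size_cat rN leq_addl.
Qed.

Lemma first_obs_block b h a r : sized b h -> size r = N ->
  first_obs (h ++ [seq (a, y) | y <- r]) = upd (first_obs h) a r.
Proof.
move=> [hb ho] rN; apply/funext => a'; rewrite /first_obs /upd obs_block.
have [->|aa'] /= := eqVneq a' a; last by rewrite cats0.
case: (ho a) => [->|oN]; first by rewrite /= -rN take_size.
rewrite takel_cat// ifF//; apply/negP => /eqP/(congr1 size).
by rewrite size_takel//= => N00; move: N0; rewrite N00.
Qed.

Lemma block_state_exp b F : block_exp b (fun h => F (first_obs h)) = state_exp b F.
Proof.
elim: b F => [|b IH] F /=; first by congr F; apply/funext.
rewrite -IH; apply: (@block_exp_ext sized sized0).
  by move=> b' h a r Sh _ _; exact: sizedS.
move=> h Sh; apply: eq_bigr => a _; rewrite /hlaw; case: (Sh) => -> _.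
rewrite mulKn//; congr (_ * _); apply: bern_exp_ext => r rN.
by rewrite (@first_obs_block b).
Qed.

Lemma state_exp_ext (S : nat -> (nat -> seq bool) -> Prop) : S 0%N (fun=> [::]) ->
  (forall b x a r, S b x -> (a < K)%N -> slaw b x a != 0 -> size r = N ->
     S b.+1 (upd x a r)) ->
  forall b F G, (forall x, S b x -> F x = G x) -> state_exp b F = state_exp b G.
Proof.
move=> S0 SS_; elim=> [|b IH] F G FG /=; first exact: FG.
apply: IH => h Sh; apply: eq_bigr => a _.
have [->|ha] := eqVneq (slaw b h a) 0; first by rewrite !mul0r.
congr (_ * _); apply: bern_exp_ext => r rN; apply: FG; exact: SS_.
Qed.

Lemma state_expD b F G : state_exp b (fun x => F x + G x) = state_exp b F + state_exp b G.
Proof.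
elim: b F G => [//|b IH] F G /=; rewrite -IH; congr state_exp; apply/funext => x.
by rewrite -big_split /=; apply: eq_bigr => a _; rewrite bern_expD mulrDr.
Qed.

Lemma state_expZ b c F : state_exp b (fun x => c * F x) = c * state_exp b F.
Proof.
elim: b F => [//|b IH] F /=; rewrite -IH; congr state_exp; apply/funext => x.
by rewrite mulr_sumr; apply: eq_bigr => a _; rewrite bern_expZ mulrCA.
Qed.

Hypothesis slaw1 : forall b x, \sum_(a < K) slaw b x a = 1.

Lemma state_exp_cst b c : state_exp b (fun=> c) = c.
Proof.
elim: b => [//|b IH] /=; rewrite -[RHS]IH; congr state_exp; apply/funext => x.
under eq_bigr => a _ do rewrite bern_exp_cst.
by rewrite -mulr_suml slaw1 mul1r.
Qed.

Lemma block_alg1 h : (0 < K)%N -> \sum_(a < K) block_alg h a = 1.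
Proof.
move=> K0; rewrite /block_alg; case: (N %| size h)%N; first exact: slaw1.
have mK : (minn (last (0%N, false) h).1 K.-1 < K)%N.
  by apply: leq_ltn_trans (geq_minr _ _) _; rewrite ltn_predL.
rewrite (bigD1 (Ordinal mK)) //= eqxx big1 ?addr0// => i.
by rewrite -(inj_eq val_inj) /= => /negbTE ->.
Qed.

Hypotheses (slaw_ge0 : forall b x a, 0 <= slaw b x a)
  (slaw_out : forall b x a, (K <= a)%N -> slaw b x a = 0).

Lemma valid_block_alg : (0 < K)%N -> valid_alg K block_alg.
Proof.
move=> K0; split=> [h a|]; last split=> [h a Ka|h]; last exact: block_alg1.
  by rewrite /block_alg; case: ifP => _; [exact: slaw_ge0|exact: ler0n].
rewrite /block_alg; case: ifP => _; first exact: slaw_out.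
rewrite gtn_eqF//; apply: leq_ltn_trans (geq_minr _ _) _.
by apply: leq_trans Ka; rewrite ltn_predL.
Qed.

(** All rounds of a block share one recommendation law, so incentives need checking only once per
    block. *)
Lemma hist_exp_rec b i T (phi : nat -> R) : (0 < K)%N -> (i < N)%N ->
  (N * b + i < T)%N ->
  Eb T (fun h => phi (rec h (N * b + i))) =
  state_exp b (fun x => \sum_(a < K) slaw b x a * phi a).
Proof.
move=> K0 iN iT; set t := (N * b + i)%N.
transitivity (Eb T (fun h => (fun h' => phi (rec h' t)) (take t.+1 h))).
  by apply: hist_exp_ext => h hT; rewrite /rec nth_take.
have e := @hist_exp_take R K block_alg mu (fun h => block_alg1 h K0) T t.+1 (fun h' => phi (rec h' t)) iT.
rewrite {}e.
rewrite /t -addnS hist_exp_block// hist_block_exp -block_state_exp.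
apply: (@block_exp_ext sized sized0).
  by move=> b' h a r Sh _ _; exact: sizedS.
move=> h [hb ho]; apply: eq_bigr => a _; rewrite /hlaw hb mulKn//; congr (_ * _).
rewrite -[RHS](bern_exp_cst i.+1 (mu a)); apply: bern_exp_ext => r ri; congr phi.
rewrite /rec nth_cat hb ltnNge leq_addr /= addKn (nth_map false)//.
by rewrite ri.
Qed.

End BlockAlgorithms.

(** * The exploration algorithm *)

Section Stages.
Context (R : realType).
Variables (K N M n0 : nat) (ar el : nat -> nat) (sg : nat -> R) (thr : R).
Hypotheses (K0 : (0 < K)%N) (N0 : (0 < N)%N) (n0N : (n0 <= N)%N).
Hypotheses (arK : forall s, (ar s < K)%N)
  (ar_inj : forall i j, (i < K)%N -> (j < K)%N -> ar i = ar j -> i = j)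
  (ar_surj : forall a, (a < K)%N -> exists2 l, (l < K)%N & ar l = a).
Hypotheses (el_lt : forall s, (el s.+1 < s.+1)%N) (el0 : el 0 = 0%N).
Hypotheses (sg0 : forall n, 0 <= sg n) (sg1 : forall n, sg n <= 1)
  (sg_mono : forall n, sg n <= sg n.+1) (sgM : sg M = 1).

(** Probability of exploring now, given that the arm is unexplored, when [sg] is the cumulative
    probability of exploration. Unlike the quotient of the increment by [1 - sg n], this form gives
    1 also when [sg n = 1], as division by 0 yields 0. *)
Definition rho (n : nat) : R := 1 - (1 - sg n.+1) / (1 - sg n).

Lemma rhoE n : rho n * (1 - sg n) = sg n.+1 - sg n.
Proof.
rewrite /rho; have [h|h] := eqVneq (1 - sg n) 0; last by field.
have := sg_mono n; have := sg1 n.+1; rewrite h mulr0; lra.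
Qed.

Lemma rho01 n : 0 <= rho n <= 1.
Proof.
have := sg1 n; have := sg1 n.+1; have := sg_mono n => h1 h2 h3.
have h4 : 0 <= (1 - sg n.+1) / (1 - sg n) by apply: divr_ge0; lra.
suff : (1 - sg n.+1) / (1 - sg n) <= 1 by rewrite /rho => h5; apply/andP; split; lra.
have [h|h] := eqVneq (1 - sg n) 0; first by rewrite h invr0 mulr0; lra.
rewrite ler_pdivrMr ?mul1r; first lra.
by rewrite lt_neqAle eq_sym h /=; lra.
Qed.

Lemma rho_eq1 n : sg n.+1 = 1 -> rho n = 1.
Proof. by rewrite /rho => ->; rewrite subrr mul0r subr0. Qed.

Definition all_zero (s : nat) (x : nat -> seq bool) : bool :=
  all (fun l => all negb (take n0 (x (ar l)))) (iota 0 s).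

Definition good (r : seq bool) : R :=
  if thr * N%:R <= (count id r)%:R then 1 else 0.

(** Off the zeros event the arm is explored with probability [sg n'], so the average there is sg n'
    * good + (1 - sg n') * rho n'. The zeros branch, where the arm is always explored, hard-codes
    the same average: this is the rerandomization that removes the dependence on the earlier
    arms. *)
Definition play_prob (s n : nat) (x : nat -> seq bool) : R :=
  if n is n'.+1 then
    if all_zero s x then sg n' * good (x (ar s)) + (sg n'.+1 - sg n')
    else if x (ar s) != [::] then good (x (ar s)) else rho n'
  else if all_zero s x then 1 else sg 0.

(** [el s] stands for the best earlier arm given that the zeros event fails. It is needed only in
    the opening block; afterwards the arms other than [ar s] keep their prior means. *)
Definition other (s n : nat) : nat := if n is _.+1 then ar 0 else ar (el s).

Definition stage_law (s n : nat) (x : nat -> seq bool) (a : nat) : R :=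
  play_prob s n x * (a == ar s)%:R + (1 - play_prob s n x) * (a == other s n)%:R.

Definition slaw (b : nat) : (nat -> seq bool) -> nat -> R :=
  stage_law (b %/ M.+1)%N (b %% M.+1)%N.

Lemma good01 r : 0 <= good r <= 1.
Proof. by rewrite /good; case: ifP; rewrite ?lexx ?ler01. Qed.

Lemma play_prob01 s n x : 0 <= play_prob s n x <= 1.
Proof.
rewrite /play_prob; case: n => [|n].
  by case: (all_zero s x); rewrite ?lexx ?ler01 ?sg0 ?sg1.
case: (all_zero s x); last by case: (_ != _); [exact: good01|exact: rho01].
have := good01 (x (ar s)); move: (good _) => g /andP[g0 g1].
have := sg0 n; have := sg1 n.+1; have := sg_mono n => h1 h2 h3.
have h4 : 0 <= sg n * g by exact: mulr_ge0.
have h5 : sg n * g <= sg n by rewrite ler_piMr.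
by apply/andP; split; lra.
Qed.

Lemma otherK s n : (other s n < K)%N. Proof. by case: n => [|n] /=; exact: arK. Qed.

Lemma sum_stage_law s n x (phi : nat -> R) :
  \sum_(a < K) stage_law s n x a * phi a =
  play_prob s n x * phi (ar s) + (1 - play_prob s n x) * phi (other s n).
Proof.
have h c a0 : (a0 < K)%N -> \sum_(a < K) c * ((nat_of_ord a) == a0)%:R * phi a = c * phi a0.
  move=> aK; rewrite (bigD1 (Ordinal aK)) //= eqxx mulr1 big1 ?addr0// => i.
  by rewrite -(inj_eq val_inj) /= => /negbTE ->; rewrite mulr0 mul0r.
rewrite -(h _ _ (arK s)) -(h _ _ (otherK s n)) -big_split /=.
by apply: eq_bigr => a _; rewrite mulrDl.
Qed.

Lemma slaw1 b x : \sum_(a < K) slaw b x a = 1.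
Proof.
have := sum_stage_law (b %/ M.+1)%N (b %% M.+1)%N x (fun=> 1).
under eq_bigr => a _ do rewrite mulr1.
by move=> ->; ring.
Qed.

Lemma slaw_ge0 b x a : 0 <= slaw b x a.
Proof.
rewrite /slaw /stage_law; have /andP[p0 p1] := play_prob01 (b %/ M.+1)%N (b %% M.+1)%N x.
by rewrite addr_ge0// mulr_ge0 ?ler0n// subr_ge0.
Qed.

Lemma slaw_out b x a : (K <= a)%N -> slaw b x a = 0.
Proof.
move=> Ka; rewrite /slaw /stage_law !gtn_eqF ?mulr0 ?addr0//.
  by apply: leq_trans Ka; exact: otherK.
by apply: leq_trans Ka; exact: arK.
Qed.

Definition explored (s : nat) (x : nat -> seq bool) : Prop := size (x (ar s)) = N.

(** A pathwise invariant: together with [sg M = 1], its last clause makes exploration certain at the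
    end of a stage. The guard [s < K] covers the end of the run, where [s = K]. *)
Definition stage_inv (s n : nat) (x : nat -> seq bool) : Prop :=
  [/\ forall l, (l < s)%N -> (l < K)%N -> explored l x,
      forall l, (s < l < K)%N -> x (ar l) = [::] &
      (s < K)%N -> if n is n'.+1 then
         [/\ x (ar s) = [::] \/ explored s x, all_zero s x -> explored s x &
             sg n' = 1 -> explored s x]
       else x (ar s) = [::]].

Lemma explored_neq0 s x : explored s x -> x (ar s) != [::].
Proof. by rewrite /explored; case: (x _) => //= h; move: N0; rewrite -h. Qed.

Lemma upd_old x a r : x a != [::] -> upd x a r = x.
Proof.
move=> xa; apply/funext => a'; rewrite /upd.
by case: (eqVneq a' a) => //= ->; rewrite (negbTE xa).
Qed.

Lemma upd_explored x a r s : explored s x -> explored s (upd x a r).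
Proof.
move=> h; have := explored_neq0 h; rewrite /explored /upd => /negbTE ->.
by rewrite andbF.
Qed.

Lemma upd_new x s r : x (ar s) = [::] -> upd x (ar s) r (ar s) = r.
Proof. by rewrite /upd eqxx => ->. Qed.

Lemma all_zero_upd s x a r : (s <= K)%N -> (forall l, (l < s)%N -> (l < K)%N -> explored l x) ->
  all_zero s (upd x a r) = all_zero s x.
Proof.
move=> sK h; apply: eq_in_all => l; rewrite mem_iota /= => ls.
have /explored_neq0/negbTE := h l ls (leq_trans ls sK).
by rewrite /upd => ->; rewrite andbF.
Qed.

Lemma stage_inv_upd s n x l0 r : (l0 <= s)%N -> (l0 < K)%N -> size r = N -> stage_inv s n x ->
  (((s < K)%N -> l0 = s) \/ (n != 0%N \/ ~~ all_zero s x) /\ ((s < K)%N -> sg n = 1 -> explored s x)) ->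
  stage_inv s n.+1 (upd x (ar l0) r).
Proof.
move=> l0s l0K rN [h1 h2 h3] hc; split.
- by move=> l ls lK; apply: upd_explored; exact: h1.
- move=> l /andP[sl lK]; rewrite /upd h2 ?sl//.
  case: eqP => //= /ar_inj e; have := e lK l0K; lia.
move=> sK; have Zu := all_zero_upd (ar l0) r (ltnW sK) h1.
have nx : x (ar s) = [::] \/ explored s x.
  by have := h3 sK; case: n {hc h3} => [|n]; [left|case].
have nu : upd x (ar l0) r (ar s) = [::] \/ explored s (upd x (ar l0) r).
  rewrite /explored /upd; case: nx => [->|h]; first by (case: (ar s == ar l0); [right|left]).
  by right; rewrite (negbTE (explored_neq0 h)) andbF.
have sub : explored s x -> explored s (upd x (ar l0) r) by exact: upd_explored.
case: hc => [/(_ sK) e|[hn hs]].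
  suff h : explored s (upd x (ar l0) r) by split => //; right.
  by case: nx => [h|]; [rewrite /explored e upd_new// -e|exact: sub].
split=> //; last by move=> /(hs sK)/sub.
rewrite Zu => Zx; case: hn => [n0'|]; last by rewrite Zx.
by apply: sub; have := h3 sK; case: n n0' {h3 hs} => // n _ [_ + _]; exact.
Qed.

Lemma stage_inv_step b x a r : stage_inv (b %/ M.+1)%N (b %% M.+1)%N x -> (a < K)%N ->
  slaw b x a != 0 -> size r = N ->
  stage_inv (b %/ M.+1)%N (b %% M.+1).+1%N (upd x a r).
Proof.
rewrite /slaw; move: (b %/ M.+1)%N (b %% M.+1)%N => s n Sx aK + rN.
have [sK|Ks] := ltnP s K; last first.
  have [l lK <-] := ar_surj aK => _.
  by apply: stage_inv_upd => //; [exact: (leq_trans (ltnW lK))|left; lia].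
rewrite /stage_law; have [-> _|aj] := eqVneq a (ar s).
  by apply: stage_inv_upd => //; left.
rewrite mulr0 add0r; have [-> h|] := eqVneq a (other s n); last by rewrite mulr0 eqxx.
(* The alternative arm is possible only if [play_prob] differs from 1. This excludes the zeros event
   in the opening block, and an unexplored arm once the exploration probability has reached 1. *)
have pn1 : play_prob s n x != 1.
  by apply: contraNneq h => ->; rewrite subrr mul0r.
have [l0 [l0s l0K ->]] : exists l0, [/\ (l0 <= s)%N, (l0 < K)%N & other s n = ar l0].
  case: (n) => [|n'] /=; last by exists 0%N.
  case: s {h aj Sx pn1} sK => [|s] sK; first by exists 0%N; rewrite el0.
  by exists (el s.+1); split => //; [exact: ltnW (el_lt s)|exact: ltn_trans (el_lt s) sK].
apply: stage_inv_upd => //; right; split.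
  case: n pn1 {h Sx aj} => [|n _]; last by left.
  by move=> h; right; apply: contra_neqN h => /= ->.
move=> _ sgn1; case: Sx => _ _ /(_ sK); case: n {h aj} sgn1 pn1 => [|n] sgn1.
  by rewrite /= sgn1 if_same eqxx.
move=> pn1 [h1 h2 _]; case: h1 => [h1|//].
case: (boolP (all_zero s x)) => [/h2//|nZ].
by move: pn1; rewrite /= (negbTE nZ) h1 eqxx /= rho_eq1 ?eqxx.
Qed.

Lemma stage_inv_next s x : stage_inv s M.+1 x -> stage_inv s.+1 0 x.
Proof.
move=> [h1 h2 h3]; split.
- move=> l; rewrite ltnS leq_eqVlt => /predU1P[->|ls] lK; last exact: h1.
  by have [_ _] := h3 lK; apply.
- by move=> l /andP[sl lK]; apply: h2; rewrite lK andbT; exact: ltnW.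
by move=> sK; apply: h2; rewrite sK ltnSn.
Qed.

Definition block_inv (b : nat) : (nat -> seq bool) -> Prop := stage_inv (b %/ M.+1)%N (b %% M.+1)%N.

Lemma block_inv0 : block_inv 0 (fun=> [::]).
Proof. by rewrite /block_inv div0n mod0n; split. Qed.

Lemma block_invS b x a r : block_inv b x -> (a < K)%N -> slaw b x a != 0 -> size r = N ->
  block_inv b.+1 (upd x a r).
Proof.
move=> Sx aK sa rN; have h := stage_inv_step Sx aK sa rN; rewrite /block_inv.
have eb := divn_eq b M.+1; have lb : (b %% M.+1 < M.+1)%N by rewrite ltn_mod.
have [e|ne] := eqVneq (b %% M.+1)%N M.
  have -> : b.+1 = ((b %/ M.+1).+1 * M.+1)%N by rewrite {1}eb e mulSn; lia.
  by rewrite mulnK// modnMl; apply: stage_inv_next; rewrite -{2}e.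
have l2 : ((b %% M.+1).+1 < M.+1)%N by lia.
have -> : b.+1 = ((b %/ M.+1) * M.+1 + (b %% M.+1).+1)%N by rewrite {1}eb addnS.
by rewrite divnMDl// modnMDl (divn_small l2) addn0 (modn_small l2).
Qed.

Variable mu : nat -> R.

Local Notation Est := (state_exp K N slaw mu).

Lemma stage_exp_ext b F G : (forall x, block_inv b x -> F x = G x) -> Est b F = Est b G.
Proof. exact: (@state_exp_ext R K N slaw mu block_inv block_inv0 block_invS b F G). Qed.

Definition zprob (s : nat) : R := \prod_(l < s) (1 - mu (ar l)) ^+ n0.

Definition gprob (s : nat) : R := bern_exp N (mu (ar s)) good.

Lemma divb s n : (n <= M)%N -> ((s * M.+1 + n) %/ M.+1 = s)%N.
Proof. by move=> nM; rewrite divnMDl// divn_small ?addn0. Qed.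

Lemma modb s n : (n <= M)%N -> ((s * M.+1 + n) %% M.+1 = n)%N.
Proof. by move=> nM; rewrite modnMDl modn_small. Qed.

Lemma stage_exp_step s n F : (n <= M)%N ->
  Est (s * M.+1 + n).+1 F = Est (s * M.+1 + n) (fun x =>
    play_prob s n x * bern_exp N (mu (ar s)) (fun r => F (upd x (ar s) r)) +
    (1 - play_prob s n x) * bern_exp N (mu (other s n)) (fun r => F (upd x (other s n) r))).
Proof.
move=> nM; rewrite [LHS]/=; congr state_exp; apply/funext => x.
rewrite -(sum_stage_law _ _ x (fun a => bern_exp N (mu a) (fun r => F (upd x a r)))).
by rewrite /slaw divb// modb.
Qed.

(** By [upd_old], playing an explored arm does not change the state, so the alternative
    recommendation drops out of the evolution of the chain. *)
Lemma other_explored s n x : (s < K)%N -> stage_inv s n x -> (n != 0%N \/ ~~ all_zero s x) ->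
  (all_zero s x -> x (ar s) != [::]) -> x (other s n) != [::].
Proof.
move=> sK [h1 h2 h3] hc hz; case: s sK h1 h2 h3 hc hz => [|s] sK h1 h2 h3 hc hz.
  by case: n h3 hc => [|n] h3 hc; [case: hc|exact: hz].
case: n h3 hc => [|n] _ _ /=; apply: explored_neq0; apply: h1 => //.
  exact: ltn_trans (el_lt s) sK.
Qed.

Lemma stage_first s (phi : seq bool -> R) : (s < K)%N ->
  let b := (s * M.+1)%N in
  Est b (fun x => (all_zero s x)%:R) = zprob s ->
  Est b.+1 (fun x => (all_zero s x)%:R * phi (x (ar s))) = zprob s * bern_exp N (mu (ar s)) phi /\
  Est b.+1 (fun x => (~~ all_zero s x)%:R * ((x (ar s) != [::])%:R * phi (x (ar s)))) =
    (1 - zprob s) * sg 0 * bern_exp N (mu (ar s)) phi.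
Proof.
move=> sK b hZ; have b0 : b = (s * M.+1 + 0)%N by rewrite addn0.
have bv : forall x, block_inv b x -> stage_inv s 0 x by move=> x; rewrite /block_inv b0 divb// modb.
have hnZ : Est b (fun x => 1 - (all_zero s x)%:R) = 1 - zprob s.
  transitivity (Est b (fun x => 1 + (-1) * (all_zero s x)%:R)).
    by congr state_exp; apply/funext => x; rewrite mulN1r.
  by rewrite state_expD state_expZ hZ (@state_exp_cst R K N slaw mu slaw1) mulN1r.
split; rewrite b0 stage_exp_step// -b0.
  rewrite mulrC -hZ -state_expZ; apply: stage_exp_ext => x /bv Sx /=.
  case: (Sx) => h1 _ /(_ sK) xs; case: (boolP (all_zero s x)) => Zx.
    rewrite subrr mul0r addr0 mul1r mulr1; apply: bern_exp_ext => r rN.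
    by rewrite all_zero_upd ?(ltnW sK)// Zx mul1r upd_new.
  rewrite (_ : bern_exp _ _ _ = bern_exp N (mu (ar s)) (fun=> 0)); last first.
    by apply: bern_exp_ext => r rN; rewrite all_zero_upd ?(ltnW sK)// (negbTE Zx) mul0r.
  rewrite (_ : bern_exp _ (mu (ar (el s))) _ = bern_exp N (mu (ar (el s))) (fun=> 0)); last first.
    by apply: bern_exp_ext => r rN; rewrite all_zero_upd ?(ltnW sK)// (negbTE Zx) mul0r.
  by rewrite !bern_exp_cst !mulr0 addr0.
rewrite -mulrA mulrC -hnZ -state_expZ; apply: stage_exp_ext => x /bv Sx /=.
case: (Sx) => h1 _ /(_ sK) xs; case: (boolP (all_zero s x)) => Zx /=.
  rewrite subrr mul0r addr0 mul1r mulr0 -[RHS](bern_exp_cst N (mu (ar s))).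
  by apply: bern_exp_ext => r rN; rewrite all_zero_upd ?(ltnW sK)// Zx mul0r.
have eo : x (ar (el s)) != [::].
  by apply: (@other_explored s 0 x) => //; [right|move=> h; rewrite h in Zx].
rewrite subr0 mulr1 [X in _ + _ * X = _](_ : _ = 0) ?mulr0 ?addr0; last first.
  rewrite -[RHS](bern_exp_cst N (mu (ar (el s)))); apply: bern_exp_ext => r rN.
  by rewrite upd_old// xs eqxx mul0r mulr0.
congr (_ * _); apply: bern_exp_ext => r rN.
rewrite all_zero_upd ?(ltnW sK)// Zx mulr1n mul1r upd_new//.
by case: r rN => [h|a r _]; [move: N0; rewrite -h|rewrite mulr1n mul1r].
Qed.

Lemma stage_next s n (phi : seq bool -> R) : (s < K)%N -> (n < M)%N ->
  let b := (s * M.+1 + n.+1)%N in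
  (forall phi, Est b (fun x => (all_zero s x)%:R * phi (x (ar s))) = zprob s * bern_exp N (mu (ar s)) phi) ->
  (forall phi, Est b (fun x => (~~ all_zero s x)%:R * ((x (ar s) != [::])%:R * phi (x (ar s)))) =
    (1 - zprob s) * sg n * bern_exp N (mu (ar s)) phi) ->
  Est b.+1 (fun x => (all_zero s x)%:R * phi (x (ar s))) = zprob s * bern_exp N (mu (ar s)) phi /\
  Est b.+1 (fun x => (~~ all_zero s x)%:R * ((x (ar s) != [::])%:R * phi (x (ar s)))) =
    (1 - zprob s) * sg n.+1 * bern_exp N (mu (ar s)) phi.
Proof.
move=> sK nM b hZ hD.
have bv : forall x, block_inv b x -> stage_inv s n.+1 x by move=> x; rewrite /block_inv divb// modb.
have eo x : stage_inv s n.+1 x -> x (ar 0) != [::].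
  move=> Sx; apply: (@other_explored s n.+1 x) => //; first by left.
  by case: Sx => _ _ /(_ sK) [_ + _] => h /h; exact: explored_neq0.
split; rewrite stage_exp_step//.
  rewrite -hZ; apply: stage_exp_ext => x /bv Sx.
  rewrite [X in _ + _ * X = _](_ : _ = (all_zero s x)%:R * phi (x (ar s))); last first.
    rewrite -[RHS](bern_exp_cst N (mu (other s n.+1))); apply: bern_exp_ext => r rN.
    by rewrite upd_old//; exact: eo.
  rewrite [X in _ * X + _ = _](_ : _ = (all_zero s x)%:R * phi (x (ar s))).
    by rewrite -mulrDl addrC subrK mul1r.
  rewrite -[RHS](bern_exp_cst N (mu (ar s))); apply: bern_exp_ext => r rN.
  case: (Sx) => h1 _ /(_ sK) [_ hs _]; rewrite all_zero_upd ?(ltnW sK)//.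
  case: (boolP (all_zero s x)) => [/hs h|]; last by rewrite !mul0r.
  by rewrite upd_old//; exact: explored_neq0.
(* The newly explored mass is [rho n] times the unexplored part of the runs off the zeros event. *)
have -> : (1 - zprob s) * sg n.+1 * bern_exp N (mu (ar s)) phi =
  (1 - zprob s) * sg n * bern_exp N (mu (ar s)) phi + rho n * bern_exp N (mu (ar s)) phi *
    ((1 - zprob s) - (1 - zprob s) * sg n).
  have -> : sg n.+1 = sg n + rho n * (1 - sg n) by rewrite rhoE; ring.
  ring.
have e1 : Est b (fun x => (all_zero s x)%:R) = zprob s.
  have := hZ (fun=> 1); rewrite bern_exp_cst mulr1 => <-.
  by congr state_exp; apply/funext => x; rewrite mulr1.
have e2 : Est b (fun x => (~~ all_zero s x)%:R * (x (ar s) != [::])%:R) = (1 - zprob s) * sg n.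
  have := hD (fun=> 1); rewrite bern_exp_cst mulr1 => <-.
  by congr state_exp; apply/funext => x; rewrite mulr1.
transitivity (Est b (fun x => (~~ all_zero s x)%:R * ((x (ar s) != [::])%:R * phi (x (ar s))) +
   rho n * bern_exp N (mu (ar s)) phi * (1 + (-1) * (all_zero s x)%:R +
      (-1) * ((~~ all_zero s x)%:R * (x (ar s) != [::])%:R)))); last first.
  by rewrite state_expD hD state_expZ !state_expD (@state_exp_cst R K N slaw mu slaw1) !state_expZ e1 e2 !mulN1r.
apply: stage_exp_ext => x /bv Sx.
rewrite [X in _ + _ * X = _](_ : _ = (~~ all_zero s x)%:R * ((x (ar s) != [::])%:R * phi (x (ar s)))); last first.
  transitivity (bern_exp N (mu (other s n.+1)) (fun=>
      (~~ all_zero s x)%:R * ((x (ar s) != [::])%:R * phi (x (ar s))))); last exact: bern_exp_cst.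
  by apply: bern_exp_ext => r rN; rewrite upd_old//; exact: eo.
case: (Sx) => h1 _ /(_ sK) [hx hs _].
rewrite /play_prob; case: (boolP (all_zero s x)) => Zx /=.
  rewrite [X in _ * X + _ = _](_ : _ = 0); first by rewrite !mul0r; ring.
  rewrite -[RHS](bern_exp_cst N (mu (ar s))); apply: bern_exp_ext => r rN.
  by rewrite all_zero_upd ?(ltnW sK)// Zx mul0r.
case: (boolP (x (ar s) != [::])) => xs /=.
  rewrite [X in _ * X + _ = _](_ : _ = phi (x (ar s))); first by ring.
  rewrite -[RHS](bern_exp_cst N (mu (ar s))); apply: bern_exp_ext => r rN.
  by rewrite upd_old// Zx xs !mul1r.
rewrite [X in _ * X + _ = _](_ : _ = bern_exp N (mu (ar s)) phi); first by ring.
apply: bern_exp_ext => r rN; rewrite all_zero_upd ?(ltnW sK)// Zx mulr1n mul1r upd_new; last first.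
  by apply/eqP; rewrite negbK in xs.
by case: r rN => [h|a r _]; [move: N0; rewrite -h|rewrite mulr1n mul1r].
Qed.



(** Whether [ar s] gets explored is decided without looking at its samples. So its samples keep the
    Bernoulli law on the zeros event, where it is always explored, and off it, where it is explored
    with probability [sg n]. *)
Lemma stage_law_inv s n : (s < K)%N -> (n <= M)%N ->
  Est (s * M.+1) (fun x => (all_zero s x)%:R) = zprob s ->
  (forall phi, Est (s * M.+1 + n.+1) (fun x => (all_zero s x)%:R * phi (x (ar s))) =
     zprob s * bern_exp N (mu (ar s)) phi) /\
  (forall phi, Est (s * M.+1 + n.+1)
      (fun x => (~~ all_zero s x)%:R * ((x (ar s) != [::])%:R * phi (x (ar s)))) =
    (1 - zprob s) * sg n * bern_exp N (mu (ar s)) phi).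
Proof.
move=> sK nM hZ; elim: n nM => [|n IH] nM.
  by rewrite addn1; split => phi; have [] := stage_first phi sK hZ.
have [h1 h2] := IH (ltnW nM).
by rewrite addnS; split => phi; have [] := stage_next phi sK nM h1 h2.
Qed.

(** Each stage adds to the zeros event a test on the samples of [ar s], which the joint law of the
    stage makes independent of the previous tests. *)
Lemma stage_start s : (s <= K)%N -> Est (s * M.+1) (fun x => (all_zero s x)%:R) = zprob s.
Proof.
elim: s => [|s IH] sK; first by rewrite /zprob big_ord0 mul0n /= mulr1n.
have [+ _] := stage_law_inv sK (leqnn M) (IH (ltnW sK)).
move=> /(_ (fun r => (all negb (take n0 r))%:R)); rewrite bern_exp_zeros//.
have -> : zprob s.+1 = zprob s * (1 - mu (ar s)) ^+ n0 by rewrite /zprob big_ord_recr.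
rewrite mulSnr => <-; congr state_exp; apply/funext => x.
rewrite /all_zero -addn1 iotaD all_cat /= add0n andbT.
by rewrite -mulnb natrM.
Qed.

(** Probability of recommending [ar s] given the mean rewards. Past the opening block [zprob] has
    cancelled, and only the mean reward of [ar s] enters, through [gprob s]. *)
Definition play_law (s n : nat) : R :=
  if n is n'.+1 then sg n' * gprob s + (sg n'.+1 - sg n')
  else sg 0 + (1 - sg 0) * zprob s.

Lemma stage_exp_play_prob s n : (s < K)%N -> (n <= M)%N ->
  Est (s * M.+1 + n) (play_prob s n) = play_law s n.
Proof.
move=> sK; have hZ := stage_start (ltnW sK); case: n => [_|n nM] /=.
  transitivity (Est (s * M.+1 + 0) (fun x => sg 0 + (1 - sg 0) * (all_zero s x)%:R)).
    congr state_exp; apply/funext => x; rewrite /play_prob.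
    by case: (all_zero s x); rewrite ?mulr1n ?mulr0n; ring.
  by rewrite state_expD state_expZ addn0 hZ (@state_exp_cst R K N slaw mu slaw1).
have [h1 h2] := stage_law_inv sK (ltnW nM) hZ.
set b := (s * M.+1 + n.+1)%N in h1 h2 *.
have e1 : Est b (fun x => (all_zero s x)%:R) = zprob s.
  have := h1 (fun=> 1); rewrite bern_exp_cst mulr1 => <-.
  by congr state_exp; apply/funext => x; rewrite mulr1.
have e2 : Est b (fun x => (~~ all_zero s x)%:R * (x (ar s) != [::])%:R) = (1 - zprob s) * sg n.
  have := h2 (fun=> 1); rewrite bern_exp_cst mulr1 => <-.
  by congr state_exp; apply/funext => x; rewrite mulr1.
transitivity (Est b (fun x => sg n * ((all_zero s x)%:R * good (x (ar s))) +
    ((sg n.+1 - sg n) * (all_zero s x)%:R +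
    ((~~ all_zero s x)%:R * ((x (ar s) != [::])%:R * good (x (ar s))) +
     rho n * (1 + (-1) * (all_zero s x)%:R + (-1) * ((~~ all_zero s x)%:R * (x (ar s) != [::])%:R)))))).
  congr state_exp; apply/funext => x.
  rewrite /play_prob.
  by case: (all_zero s x); case: (x (ar s) != [::]); rewrite /= ?mulr1n ?mulr0n; ring.
rewrite !state_expD !state_expZ !state_expD !state_expZ (@state_exp_cst R K N slaw mu slaw1) h1 h2 e1 e2 /gprob.
move: (bern_exp _ _ _) => g.
have -> : rho n * (1 + -1 * zprob s + -1 * ((1 - zprob s) * sg n)) =
   (1 - zprob s) * (rho n * (1 - sg n)) by ring.
by rewrite rhoE; ring.
Qed.

Local Notation alg := (block_alg K N slaw).

Lemma hist_exp_stage s n i T phi : (s < K)%N -> (n <= M)%N -> (i < N)%N ->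
  (N * (s * M.+1 + n) + i < T)%N ->
  hist_exp K alg mu T (fun h => phi (rec h (N * (s * M.+1 + n) + i))) =
  play_law s n * phi (ar s) + (1 - play_law s n) * phi (other s n).
Proof.
move=> sK nM iN iT; rewrite (hist_exp_rec N0 mu slaw1)//.
rewrite -(stage_exp_play_prob sK nM).
transitivity (Est (s * M.+1 + n) (fun x =>
   phi (other s n) + (phi (ar s) - phi (other s n)) * play_prob s n x)).
  congr state_exp; apply/funext => x; rewrite /slaw divb// modb// sum_stage_law; ring.
by rewrite state_expD state_expZ (@state_exp_cst R K N slaw mu slaw1); ring.
Qed.

(** The invariant holds on every history of positive probability, so no estimate of a failure
    probability is needed. *)
Lemma hist_exp_collect (F : history -> R) :
  (forall h, (forall a, (a < K)%N -> (N <= size (obs h a))%N) -> F h = 1) ->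
  hist_exp K alg mu (N * (K * M.+1)) F = 1.
Proof.
move=> hF; rewrite hist_block_exp//.
transitivity (block_exp K N slaw mu (K * M.+1) (fun h => (fun=> 1) (first_obs N h))); last first.
  transitivity (Est (K * M.+1) (fun=> 1)); last exact: (@state_exp_cst R K N slaw mu slaw1).
  exact: (@block_state_exp R K N slaw N0 mu (K * M.+1) (fun=> 1)).
apply: (@block_exp_ext R K N slaw mu (fun b h => sized N b h /\ block_inv b (first_obs N h))).
- by split; [exact: sized0|exact: block_inv0].
- move=> b h a r [Sh Bh] aK ha rN; split; first exact: sizedS.
  rewrite (first_obs_block N0 a Sh rN); apply: block_invS => //.
  by move: ha; rewrite /hlaw; case: Sh => -> _; rewrite mulKn.
move=> h [_]; rewrite /block_inv mulnK// modnMl => -[h1 _ _].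
apply: hF => a aK; have [l lK <-] := ar_surj aK.
have := h1 l lK lK; rewrite /explored /first_obs size_take.
by case: (ltnP N (size (obs h (ar l)))) => [/ltnW //|_ ->].
Qed.

Lemma valid_stage_alg : valid_alg K alg.
Proof. by apply: (@valid_block_alg R K N slaw slaw1 slaw_ge0 slaw_out). Qed.

End Stages.

(** * Incentives *)

Section SinglePrior.
Context (R : realType) (P : probability R R).
Local Notation I01 := `[(0:R), 1]%classic.
Hypothesis P1 : P I01 = 1%E.
Let mI : measurable I01. Proof. exact: measurable_itv. Qed.
Local Notation E := (Eone P).

Let EB f g : bmeas I01 f -> bmeas I01 g -> E (fun x => f x - g x) = E f - E g.
Proof. exact: ExpB. Qed.
Let EZ c f : bmeas I01 f -> E (fun x => c * f x) = c * E f.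
Proof. exact: ExpZ. Qed.
Let Ec c : E (fun=> c) = c. Proof. exact: Exp_cst. Qed.
Let Ele f g : bmeas I01 f -> bmeas I01 g -> (forall x, 0 <= x <= 1 -> f x <= g x) ->
  E f <= E g.
Proof. by move=> bf bg fg; apply: (Exp_le mI P1 bf bg) => x /I01P; exact: fg. Qed.

Lemma bmeas_onem_exp n : bmeas I01 (fun x : R => (1 - x) ^+ n).
Proof.
by apply: bmeasX; apply: bmeasB; [exact: bmeas_cst|exact: bmeas_id].
Qed.

(* Chebyshev's association inequality, by comparison with the value at the mean. *)
Lemma mean_onem_exp n :
  E (fun x => x * (1 - x) ^+ n) <= mean P * E (fun x => (1 - x) ^+ n).
Proof.
set m := mean P; have m0 : 0 <= m by exact: mean_ge0.
have m1 : m <= 1 by exact: mean_le1.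
have b1 : bmeas I01 (fun x : R => x * (1 - x) ^+ n).
  by apply: bmeasM; [exact: bmeas_id|exact: bmeas_onem_exp].
have b2 := bmeasZ m (bmeas_onem_exp n).
rewrite -EZ; last exact: bmeas_onem_exp.
rewrite -subr_le0 -EB//.
apply: (@le_trans _ _ (E (fun x => (1 - m) ^+ n * (x - m)))).
  apply: Ele; [exact: bmeasB| |].
    by apply: bmeasZ; apply: bmeasB; [exact: bmeas_id|exact: bmeas_cst].
  move=> x /andP[x0 x1]; rewrite -mulrBl mulrC -subr_ge0 -mulrBl.
  have [xm|mx] := leP x m.
    rewrite mulr_le0//; last by rewrite subr_le0.
    by rewrite subr_le0 lerXn2r ?nnegrE ?subr_ge0// lerD2l lerN2.
  rewrite mulr_ge0//; last by rewrite subr_ge0 ltW.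
  by rewrite subr_ge0 lerXn2r ?nnegrE ?subr_ge0// lerD2l lerN2 ltW.
rewrite EZ; last by apply: bmeasB; [exact: bmeas_id|exact: bmeas_cst].
rewrite EB; [|exact: bmeas_id|exact: bmeas_cst].
by rewrite Ec -/(mean P) subrr mulr0.
Qed.

Variables (d m0 : R).
Hypotheses (d0 : 0 < d) (m0_ge0 : 0 <= m0) (m01 : m0 <= 1)
  (low : d <= E (fun x => Num.max (m0 - x) 0)).

Let bneg : bmeas I01 (fun x => Num.max (m0 - x) 0 - d / 2).
Proof. by apply: bmeasB; [exact: bmeas_neg|exact: bmeas_cst]. Qed.

Let Eneg : d / 2 <= E (fun x => Num.max (m0 - x) 0 - d / 2).
Proof.
rewrite EB; [|exact: bmeas_neg|exact: bmeas_cst].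
by have dd := d0; rewrite Ec lerBrDl; apply: le_trans low; lra.
Qed.

(** The function (m0 - x)_+ - d/2 has mean at least d/2, is at most 1, and is positive only where x
    < m0 - d/2, hence where 1 - x > d/2. It serves as a lower bound for the indicator of that
    region. *)
Lemma onem_exp_lower n : (d / 2) ^+ n * (d / 2) <= E (fun x => (1 - x) ^+ n).
Proof.
have dd := d0; have mm := m01; have dn0 : 0 <= (d / 2) ^+ n by apply: exprn_ge0; lra.
apply: (@le_trans _ _ (E (fun x => (d / 2) ^+ n * (Num.max (m0 - x) 0 - d / 2)))).
  by rewrite EZ// ler_wpM2l.
apply: Ele; [exact: bmeasZ|exact: bmeas_onem_exp|].
move=> x /andP[x0 x1].
have o0 : 0 <= (1 - x) ^+ n by apply: exprn_ge0; lra.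
have [h|h] := leP x (m0 - d / 2).
  apply: (@le_trans _ _ ((d / 2) ^+ n)).
    by rewrite ler_piMr// maxEle; case: ifP => _; lra.
  by apply: lerXn2r; rewrite ?nnegrE; lra.
apply: le_trans o0; rewrite mulr_ge0_le0// maxEle; case: ifP => _; lra.
Qed.

(** Values below m0 - d/2 get weight at least a^n with a = 1 - m0 + d/2, values above m0 at most (1
    - m0)^n. The hypothesis makes [n] so large that the loss from the latter is at most half of the
    guaranteed gain a^n * d/2. *)
Lemma gap_onem_exp n : (1 - m0) ^+ n <= d / 4 * (1 - m0 + d / 2) ^+ n ->
  d / 4 * (d / 2) ^+ n <= E (fun x => (m0 - x) * (1 - x) ^+ n).
Proof.
move=> hn; have dd := d0; have mm := m01; have mm0 := m0_ge0; set a := 1 - m0 + d / 2.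
have a0 : d / 2 <= a by rewrite /a; lra.
have an : (d / 2) ^+ n <= a ^+ n by apply: lerXn2r; rewrite ?nnegrE; lra.
have an0 : 0 <= a ^+ n by apply: exprn_ge0; lra.
have b1 : bmeas I01 (fun x => a ^+ n * (Num.max (m0 - x) 0 - d / 2) - (1 - m0) ^+ n).
  by apply: bmeasB; [exact: bmeasZ|exact: bmeas_cst].
apply: (@le_trans _ _ (E (fun x => a ^+ n * (Num.max (m0 - x) 0 - d / 2) - (1 - m0) ^+ n))).
  rewrite EB ?EZ// ?Ec; [|exact: bmeasZ|exact: bmeas_cst].
  have h1 : a ^+ n * (d / 2) <= a ^+ n * E (fun x => Num.max (m0 - x) 0 - d / 2).
    by rewrite ler_wpM2l.
  have h2 : d / 4 * (d / 2) ^+ n <= d / 4 * a ^+ n by rewrite ler_wpM2l//; lra.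
  rewrite -/a in hn; lra.
apply: Ele => //.
  apply: bmeasM; last exact: bmeas_onem_exp.
  by apply: bmeasB; [exact: bmeas_cst|exact: bmeas_id].
move=> x /andP[x0 x1].
have o0 : 0 <= (1 - x) ^+ n by apply: exprn_ge0; lra.
have q0 : 0 <= (1 - m0) ^+ n by apply: exprn_ge0; lra.
have [h|h] := leP x (m0 - d / 2).
  have h1 : (m0 - x) * a ^+ n <= (m0 - x) * (1 - x) ^+ n.
    rewrite ler_wpM2l; [by []|lra|].
    by apply: lerXn2r; rewrite ?nnegrE /a; lra.
  have h2 : Num.max (m0 - x) 0 = m0 - x by rewrite max_l//; lra.
  have h3 : 0 <= a ^+ n * (d / 2) by apply: mulr_ge0 => //; lra.
  rewrite h2; lra.
have [xm|mx] := leP x m0.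
  have h1 : 0 <= (m0 - x) * (1 - x) ^+ n by apply: mulr_ge0 => //; lra.
  have h2 : a ^+ n * (Num.max (m0 - x) 0 - d / 2) <= 0.
    by rewrite mulr_ge0_le0// maxEle; case: ifP => _; lra.
  lra.
have h2 : a ^+ n * (Num.max (m0 - x) 0 - d / 2) <= 0.
  by rewrite mulr_ge0_le0// maxEle; case: ifP => _; lra.
have h3 : (1 - x) ^+ n <= (1 - m0) ^+ n by apply: lerXn2r; rewrite ?nnegrE; lra.
have h4 : (x - m0) * (1 - x) ^+ n <= (1 - x) ^+ n by rewrite ler_piMl//; lra.
lra.
Qed.

End SinglePrior.

(** * The surplus of an arm that passes its empirical test *)

Section Gain.
Context (R : realType) (P : probability R R).
Local Notation I01 := `[(0:R), 1]%classic.
Hypothesis P1 : P I01 = 1%E.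
Let mI : measurable I01. Proof. exact: measurable_itv. Qed.
Local Notation E := (Eone P).
Variables (d thr : R) (N : nat).
Hypotheses (d0 : 0 < d) (N0 : (0 < N)%N) (Nd : 1 <= N%:R * d ^+ 2).

(* Testing by the empirical mean loses at most the mean absolute deviation,
   which is bounded by [y <= y^2 / d + d / 4] and the binomial variance. *)
Lemma good_loss m : 0 <= m <= 1 ->
  Num.max (m - thr) 0 - d / 2 <= (m - thr) * bern_exp N m (good N thr).
Proof.
have dd := d0; move=> m01; have /andP[mge0 mle1] := m01.
have NR : 0 < N%:R :> R by rewrite ltr0n.
rewrite -bern_expZ -(bern_exp_cst N m (Num.max (m - thr) 0)).
(* With this scaling [c * y ^+ 2] is (y/N)^2/d, so a deviation y/N is at most c * y^2 + d/4 by
   completing a square, and the mean of c * y^2 is at most d/4 because N d^2 >= 1. *)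
set c := (N%:R ^+ 2 * d)^-1.
have c0 : 0 < c by rewrite invr_gt0 mulr_gt0 ?exprn_gt0.
have key r : Num.max (m - thr) 0 <= (m - thr) * good N thr r +
    (c * ((count id r)%:R - N%:R * m) ^+ 2 + d / 4).
  set y := (count id r)%:R - N%:R * m.
  have h1 : forall u : R, N%:R * u <= y \/ N%:R * u <= - y -> u <= c * y ^+ 2 + d / 4.
    move=> u hu; have h2 : (2 * y) ^+ 2 * c = (N%:R * (2 * y / N%:R)) ^+ 2 * c.
      by congr (_ ^+ 2 * _); field; rewrite gt_eqF.
    pose v := y / N%:R.
    have yE : y = N%:R * v by rewrite /v; field; rewrite gt_eqF.
    have cE : c * y ^+ 2 = v ^+ 2 / d.
      by rewrite yE /c; field; rewrite !gt_eqF.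
    have uv : u <= v \/ u <= - v.
      by case: hu; rewrite yE -?mulrN ler_pM2l// => h; [left|right].
    rewrite cE.
    have sq : 0 <= (v / d - 1 / 2) ^+ 2 * d by rewrite mulr_ge0 ?sqr_ge0 ?ltW.
    have sq' : 0 <= (v / d + 1 / 2) ^+ 2 * d by rewrite mulr_ge0 ?sqr_ge0 ?ltW.
    have e1 : (v / d - 1 / 2) ^+ 2 * d = v ^+ 2 / d + d / 4 - v by field; rewrite gt_eqF.
    have e2 : (v / d + 1 / 2) ^+ 2 * d = v ^+ 2 / d + d / 4 + v by field; rewrite gt_eqF.
    by case: uv => ?; lra.
  have y0 : 0 <= c * y ^+ 2 + d / 4.
    by apply: addr_ge0; [rewrite mulr_ge0 ?sqr_ge0// ltW|lra].
  rewrite /good; case: ifPn => [h|]; rewrite ?mulr1 ?mulr0 ?add0r.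
    rewrite ge_max; apply/andP; split; first lra.
    suff : thr - m <= c * y ^+ 2 + d / 4 by lra.
    by apply: h1; left; rewrite mulrBr [_ * thr]mulrC /y; lra.
  rewrite -ltNge => h; rewrite ge_max y0 andbT; apply: h1; right.
  rewrite mulrBr [_ * thr]mulrC /y; lra.
have : bern_exp N m (fun=> Num.max (m - thr) 0) <= bern_exp N m (fun r => (m - thr) * good N thr r +
    (c * ((count id r)%:R - N%:R * m) ^+ 2 + d / 4)) by apply: bern_exp_le.
rewrite !bern_expD [in X in _ <= X]bern_exp_cst (bern_expZ _ _ c) bern_exp_var => h.
suff : c * (N%:R * (m * (1 - m))) <= d / 4 by lra.
have h4 : m * (1 - m) <= 1 / 4.
  by have : 0 <= (m - 1 / 2) ^+ 2 := sqr_ge0 _; rewrite expr2; lra.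
rewrite /c ler_pdivrMl ?mulr_gt0 ?exprn_gt0//.
have h5 : N%:R * (m * (1 - m)) <= N%:R * (1 / 4) by rewrite ler_wpM2l.
have h6 : N%:R * 1 <= N%:R * (N%:R * d ^+ 2) by rewrite ler_wpM2l.
have -> : N%:R ^+ 2 * d * (d / 4) = N%:R * (N%:R * d ^+ 2) / 4 by field.
lra.
Qed.

Lemma good_gain : d < E (fun x => Num.max (x - thr) 0) ->
  thr * E (fun x => bern_exp N x (good N thr)) + d / 2 <= E (fun x => x * bern_exp N x (good N thr)).
Proof.
move=> hE; have bg := bmeas_bern_exp N (good N thr).
have bxg : bmeas I01 (fun x : R => x * bern_exp N x (good N thr)).
  by apply: bmeasM => //; exact: bmeas_id.
have btg := bmeasZ thr bg.
rewrite -lerBrDl -(ExpZ mI P1 thr bg) -(ExpB mI P1 bxg btg).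
apply: (@le_trans _ _ (Exp P (fun x => Num.max (x - thr) 0 - d / 2))).
  rewrite (ExpB mI P1 (bmeas_pos thr) (bmeas_cst _ _)) Exp_cst.
  by move: hE; rewrite /Eone /Exp; lra.
apply: (Exp_le mI P1).
- by apply: bmeasB; [exact: bmeas_pos|exact: bmeas_cst].
- exact: bmeasB.
by move=> x /I01P x01; rewrite -mulrBl; exact: good_loss.
Qed.

End Gain.

(** * Verification of the BIC property *)

Section Incentives.
Context (R : realType).
Local Notation I01 := `[(0:R), 1]%classic.
Let mI : measurable I01. Proof. exact: measurable_itv. Qed.
Variables (K N M n0 : nat) (P : nat -> probability R R) (ar el : nat -> nat).
Variables (sg : nat -> R) (thr d : R).
Hypotheses (P01 : forall i, (i < K)%N -> P i I01 = 1%E)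
  (arK : forall s, (ar s < K)%N)
  (ar_inj : forall i j, (i < K)%N -> (j < K)%N -> ar i = ar j -> i = j)
  (ar_surj : forall a, (a < K)%N -> exists2 l, (l < K)%N & ar l = a).

Let PA l : P (ar l) I01 = 1%E. Proof. by apply: P01; exact: arK. Qed.

Lemma prod_ar (F : nat -> R) : \prod_(l < K) F (ar l) = \prod_(i < K) F i.
Proof.
rewrite -(big_mkord xpredT (fun l => F (ar l))) -(big_mkord xpredT F).
rewrite /index_iota subn0 -(big_map ar xpredT F); apply: perm_big.
apply: uniq_perm; last 1 first.
- move=> a; rewrite mem_iota /= add0n; apply/mapP/idP.
    by move=> [l _ ->]; exact: arK.
  by move=> /ar_surj [l lK <-]; exists l => //; rewrite mem_iota.
- rewrite map_inj_in_uniq ?iota_uniq// => i j.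
  by rewrite !mem_iota /= !add0n; exact: ar_inj.
exact: iota_uniq.
Qed.

Lemma Einst_prod_ar (f : nat -> R -> R) : (forall l, bmeas I01 (f l)) ->
  Einst K P (fun mu => \prod_(l < K) f l (mu (ar l))) =
  \prod_(l < K) Eone (P (ar l)) (f l).
Proof.
move=> bf; pose linv i := index i [seq ar l | l <- iota 0 K].
have linvK l : (l < K)%N -> linv (ar l) = l.
  move=> lK; have u : uniq [seq ar l | l <- iota 0 K].
    rewrite map_inj_in_uniq ?iota_uniq// => i j.
    by rewrite !mem_iota /= !add0n; exact: ar_inj.
  have e : ar l = nth 0%N [seq ar l | l <- iota 0 K] l.
    by rewrite (nth_map 0%N) ?size_iota// nth_iota.
  by rewrite /linv {1}e index_uniq// size_map size_iota.
transitivity (Einst K P (fun mu => \prod_(i < K) f (linv i) (mu i))).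
  congr Einst; apply/funext => mu; rewrite -(prod_ar (fun i => f (linv i) (mu i))).
  by apply: eq_bigr => l _; rewrite linvK.
rewrite (@Einst_prod R K P (fun i => f (linv i)))//.
rewrite -(prod_ar (fun i => Eone (P i) (f (linv i)))).
by apply: eq_bigr => l _; rewrite linvK.
Qed.

(** The unnormalized posterior mean of [ar a] under a product likelihood, already factored by
    independence. *)
Definition Uexp (h : nat -> R -> R) (a : nat) : R :=
  Eone (P (ar a)) (fun x => x * h a x) *
  \prod_(l < K | l != a :> nat) Eone (P (ar l)) (h l).

Lemma Einst_Uexp (h : nat -> R -> R) a : (a < K)%N -> (forall l, bmeas I01 (h l)) ->
  Einst K P (fun mu => mu (ar a) * \prod_(l < K) h l (mu (ar l))) = Uexp h a.
Proof.
move=> aK bh; pose f l x := if l == a then x * h l x else h l x.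
have bf l : bmeas I01 (f l).
  by rewrite /f; case: eqP => _ //; apply: bmeasM => //; exact: bmeas_id.
transitivity (Einst K P (fun mu => \prod_(l < K) f l (mu (ar l)))).
  congr Einst; apply/funext => mu.
  rewrite (bigD1 (Ordinal aK)) //= [RHS](bigD1 (Ordinal aK)) //= /f eqxx mulrA.
  congr (_ * _); apply: eq_bigr => l; rewrite -(inj_eq val_inj) /=.
  by move=> /negbTE ->.
rewrite Einst_prod_ar// (bigD1 (Ordinal aK)) //= /Uexp /f eqxx.
by congr (_ * _); apply: eq_big => // l; rewrite -(inj_eq val_inj) /= => /negbTE ->.
Qed.

Lemma Uexp_1 a : Uexp (fun _ _ => 1) a = mean (P (ar a)).
Proof.
rewrite /Uexp big1 ?mulr1; last by move=> l _; exact: (Exp_cst (P (ar l)) 1).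
by congr Eone; apply/funext => x; rewrite mulr1.
Qed.

Let mC := @measurable_cube R.
Let LC : law P K (@cube R) = 1%E. Proof. exact: (law_cube P01 (leqnn K)). Qed.

Lemma bmeas_prod_ar (h : nat -> R -> R) : (forall l, bmeas I01 (h l)) ->
  bmeas (@cube R) (fun mu : seqT R => \prod_(l < K) h l (mu (ar l))).
Proof. by move=> bh; apply: bmeas_prod => l _; exact: bmeas_coord. Qed.

(** Every law given by [play_law], and its complement, is a constant plus a multiple of a product
    likelihood, so this formula covers all the incentive constraints. *)
Lemma Einst_gap (h : nat -> R -> R) a b (c1 c2 : R) : (a < K)%N -> (b < K)%N ->
  (forall l, bmeas I01 (h l)) ->
  Einst K P (fun mu => (c1 + c2 * \prod_(l < K) h l (mu (ar l))) * (mu (ar a) - mu (ar b))) =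
  c1 * (mean (P (ar a)) - mean (P (ar b))) + c2 * (Uexp h a - Uexp h b).
Proof.
move=> aK bK bh.
have bc i : bmeas (@cube R) (fun mu : seqT R => mu i) by exact: (bmeas_coord i (bmeas_id R)).
have bp := bmeas_prod_ar bh.
have bcp i := bmeasM (bc i) bp.
have b1 := bmeasB (bc (ar a)) (bc (ar b)).
have b2 := bmeasB (bcp (ar a)) (bcp (ar b)).
transitivity (Einst K P (fun mu => c1 * (mu (ar a) - mu (ar b)) +
   c2 * (mu (ar a) * \prod_(l < K) h l (mu (ar l)) -
         mu (ar b) * \prod_(l < K) h l (mu (ar l))))).
  by congr Einst; apply/funext => mu; ring.
have Ec i : (i < K)%N -> Exp (law P K) (fun mu : seqT R => mu (ar i)) = mean (P (ar i)).
  move=> iK; rewrite -(EinstE P01 (bc _)) -Uexp_1 -Einst_Uexp//; last by move=> l; exact: bmeas_cst.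
  congr Einst; apply/funext => mu; by rewrite big1 ?mulr1.
rewrite (EinstE P01); last by apply: bmeasD; exact: bmeasZ.
rewrite (ExpD mC LC (bmeasZ _ b1) (bmeasZ _ b2)) (ExpZ mC LC _ b1) (ExpZ mC LC _ b2).
rewrite (ExpB mC LC (bc _) (bc _)) (ExpB mC LC (bcp _) (bcp _)) !Ec//.
by rewrite -!(EinstE P01 (bcp _)) !Einst_Uexp.
Qed.

Definition wzero (s l : nat) (x : R) : R := if (l < s)%N then (1 - x) ^+ n0 else 1.

Lemma bmeas_wz s l : bmeas I01 (wzero s l).
Proof. by rewrite /wzero; case: (l < s)%N; [exact: bmeas_onem_exp|exact: bmeas_cst]. Qed.

Lemma zprob_prod s mu : (s <= K)%N ->
  zprob n0 ar mu s = \prod_(l < K) wzero s l (mu (ar l)).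
Proof.
move=> sK; rewrite /zprob (big_ord_widen _ (fun l => (1 - mu (ar l)) ^+ n0) sK) big_mkcond /=.
by apply: eq_bigr => l _; rewrite /wzero; case: ifP.
Qed.

Definition hgood (s l : nat) (x : R) : R := if l == s then bern_exp N x (good N thr) else 1.

Lemma bmeas_hg s l : bmeas I01 (hgood s l).
Proof. by rewrite /hgood; case: eqP => _; [exact: bmeas_bern_exp|exact: bmeas_cst]. Qed.

Lemma gprob_prod s mu : (s < K)%N ->
  gprob N ar thr mu s = \prod_(l < K) hgood s l (mu (ar l)).
Proof.
move=> sK; rewrite (bigD1 (Ordinal sK)) //= /hgood eqxx big1 ?mulr1// => l.
by rewrite -(inj_eq val_inj) /= => /negbTE ->.
Qed.

Local Notation mean_ l := (mean (P (ar l))).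
Local Notation G s := (Eone (P (ar s)) (fun x => bern_exp N x (good N thr))).
Local Notation H s := (Eone (P (ar s)) (fun x => x * bern_exp N x (good N thr))).

Lemma Uexp_hg s a : (s < K)%N -> Uexp (hgood s) a = if a == s then H s else mean_ a * G s.
Proof.
move=> sK; rewrite /Uexp; have [->|as_] := eqVneq a s.
  rewrite big1 ?mulr1; first by congr Eone; apply/funext => x; rewrite /hgood eqxx.
  by move=> l ls; rewrite /hgood (negbTE ls); exact: (Exp_cst (P (ar l)) 1).
congr (_ * _).
  by congr Eone; apply/funext => x; rewrite /hgood (negbTE as_) mulr1.
rewrite (bigD1 (Ordinal sK)) /= 1?eq_sym// big1 ?mulr1.
  by congr Eone; apply/funext => x; rewrite /hgood eqxx.
move=> l /andP[_]; rewrite -(inj_eq val_inj) /= => ls.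
by rewrite /hgood (negbTE ls); exact: (Exp_cst (P (ar l)) 1).
Qed.

Definition Zbar (s : nat) : R := \prod_(l < K) Eone (P (ar l)) (wzero s l).

Lemma Uexp_wz_ge s a : (a < K)%N -> (s <= a)%N -> Uexp (wzero s) a = mean_ a * Zbar s.
Proof.
move=> aK sa; rewrite /Uexp /Zbar [X in _ = _ * X](bigD1 (Ordinal aK)) //=.
have e : wzero s a = fun=> 1 by apply/funext => x; rewrite /wzero ltnNge sa.
rewrite e [X in _ = _ * (X * _)](Exp_cst (P (ar a)) 1) mul1r.
congr (_ * _); by congr Eone; apply/funext => x; rewrite mulr1.
Qed.

Lemma wz01 s l x : 0 <= x <= 1 -> 0 <= wzero s l x <= 1.
Proof.
move=> /andP[x0 x1]; rewrite /wzero; case: ifP => _; last by rewrite ler01 lexx.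
by rewrite exprn_ge0 ?exprn_ile1//; lra.
Qed.

Lemma Ewz01 s l : 0 <= Eone (P (ar l)) (wzero s l) <= 1.
Proof.
have b := bmeas_wz s l; apply/andP; split.
  by apply: (Exp_ge0 mI (PA l) b) => x /I01P /(wz01 s l)/andP[].
rewrite -(Exp_cst (P (ar l)) 1).
by apply: (Exp_le mI (PA l) b (bmeas_cst _ _)) => x /I01P /(wz01 s l)/andP[].
Qed.

Lemma Zbar01 s : 0 <= Zbar s <= 1.
Proof.
apply/andP; split; first by apply: prodr_ge0 => l _; have /andP[] := Ewz01 s l.
by apply: Num.Theory.prodr_ile1 => l _; exact: Ewz01.
Qed.

(** Zeros from an arm can only lower its mean; the factors of the other arms are common to both
    sides. *)
Lemma Uexp_wz_le s a : (a < K)%N -> Uexp (wzero s) a <= mean_ a * Zbar s.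
Proof.
move=> aK; have [sa|as_] := leqP s a; first by rewrite Uexp_wz_ge.
rewrite /Uexp /Zbar [X in _ <= _ * X](bigD1 (Ordinal aK)) //= mulrA.
apply: ler_wpM2r; first by apply: prodr_ge0 => l _; have /andP[] := Ewz01 s l.
have e : wzero s a = fun x => (1 - x) ^+ n0 by apply/funext => x; rewrite /wzero as_.
by rewrite e; exact: mean_onem_exp.
Qed.

Hypotheses (K0 : (0 < K)%N) (N0 : (0 < N)%N) (n0N : (n0 <= N)%N).
Hypotheses (el_lt : forall s, (el s.+1 < s.+1)%N) (el0 : el 0 = 0%N).
Hypothesis el_max : forall s l, (l < s)%N ->
  mean_ l - Uexp (wzero s) l <= mean_ (el s) - Uexp (wzero s) (el s).
Hypotheses (sg0 : forall n, 0 <= sg n) (sg1 : forall n, sg n <= 1)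
  (sg_mono : forall n, sg n <= sg n.+1) (sgM : sg M = 1)
  (sg_step : forall n, sg n.+1 - sg n <= sg n * (d / 2)).
Hypotheses (sorted : forall i j, (i <= j)%N -> (j < K)%N -> mean_ j <= mean_ i)
  (mean_thr : forall i, (i < K)%N -> mean_ i <= thr)
  (gain : forall s, (s < K)%N -> thr * G s + d / 2 <= H s)
  (margin : forall s a, (a < s)%N -> (s < K)%N ->
     2 * sg 0 <= mean_ s * Zbar s - Uexp (wzero s) a).

Let mean01 l : 0 <= mean_ l <= 1.
Proof. by rewrite mean_ge0 ?mean_le1. Qed.

Let G01 s : 0 <= G s <= 1.
Proof.
have b := bmeas_bern_exp N (good N thr).
have g01 x : 0 <= x <= 1 -> 0 <= bern_exp N x (good N thr) <= 1.
  move=> x01; have h r := good01 N thr r; apply/andP; split.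
    by rewrite -[X in X <= _](bern_exp_cst N x); apply: bern_exp_le => // r _; have /andP[] := h r.
  by rewrite -[X in _ <= X](bern_exp_cst N x); apply: bern_exp_le => // r _; have /andP[] := h r.
apply/andP; split.
  by apply: (Exp_ge0 mI (PA s) b) => x /I01P /g01/andP[].
rewrite -(Exp_cst (P (ar s)) 1).
by apply: (Exp_le mI (PA s) b (bmeas_cst _ _)) => x /I01P /g01/andP[].
Qed.

Local Notation play mu := (play_law N n0 ar sg thr mu).

Lemma play_incentive s n b : (0 < s)%N -> (s < K)%N -> (b < K)%N ->
  0 <= Einst K P (fun mu => play mu s n * (mu (ar s) - mu (ar b))).
Proof.
move=> s0 sK bK; case: n => [|n].
  rewrite [X in 0 <= X](_ : _ = Einst K P (fun mu =>
    (sg 0 + (1 - sg 0) * \prod_(l < K) wzero s l (mu (ar l))) * (mu (ar s) - mu (ar b)))); last first.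
    by congr Einst; apply/funext => mu; rewrite /play_law zprob_prod// ltnW.
  rewrite Einst_gap//; last by move=> l; exact: bmeas_wz.
  have k0 := sg0 0; have k1 := sg1 0; rewrite Uexp_wz_ge//.
  have [sb|bs] := leqP s b.
    rewrite Uexp_wz_ge// -mulrBl; have h := sorted sb bK; have /andP[z0 _] := Zbar01 s.
    by rewrite addr_ge0// mulr_ge0 ?mulr_ge0//; lra.
  (* Against an earlier arm, a loss of at most 1 with weight [sg 0] meets a gain of at least
     [2 * sg 0] with weight [1 - sg 0]. What remains is sg 0 * (1 - 2 * sg 0), nonnegative because
     the gain is at most 1. *)
  have hm := margin bs sK; set X := mean_ s * _ - _ in hm *.
  have mm := mean01 s; have mb := mean01 b.
  have XZ : X <= 1.
    have u0 : 0 <= Uexp (wzero s) b.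
      apply: mulr_ge0; last by apply: prodr_ge0 => l _; have /andP[] := Ewz01 s l.
      apply: (Exp_ge0 mI (PA b)); first by apply: bmeasM; [exact: bmeas_id|exact: bmeas_wz].
      by move=> x /I01P x01; have := wz01 s b x01; move=> /andP[w0 _]; case/andP: x01 => *; rewrite mulr_ge0.
    have /andP[z0 z1] := Zbar01 s; case/andP: mm => m0 m1.
    have : mean_ s * Zbar s <= 1 by rewrite mulr_ile1.
    by rewrite /X; lra.
  have h1 : sg 0 * (mean_ b - mean_ s) <= sg 0 by rewrite ler_piMr//; lra.
  have h2 : (1 - sg 0) * (2 * sg 0) <= (1 - sg 0) * X by rewrite ler_wpM2l//; lra.
  have h3 : 0 <= sg 0 * (1 - 2 * sg 0) by rewrite mulr_ge0//; lra.
  lra.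
rewrite [X in 0 <= X](_ : _ = Einst K P (fun mu =>
    ((sg n.+1 - sg n) + sg n * \prod_(l < K) hgood s l (mu (ar l))) * (mu (ar s) - mu (ar b)))); last first.
  by congr Einst; apply/funext => mu; rewrite /play_law gprob_prod// addrC.
rewrite Einst_gap//; last by move=> l; exact: bmeas_hg.
rewrite !Uexp_hg// eqxx; have [->|bs] := eqVneq b s; first by rewrite !subrr !mulr0 addr0.
(* The increment of [sg] costs at most 1 per unit, and [sg_step] bounds it by the surplus sg n * d/2
   of the test. *)
have st := sg_step n; have mo := sg_mono n; have gn := gain sK; have sn := sg0 n.
have mt := mean_thr bK; have /andP[g0 g1] := G01 s.
have /andP[? ?] := mean01 s; have /andP[? ?] := mean01 b.
have h1 : mean_ b * G s <= thr * G s by rewrite ler_wpM2r.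
have h2 : sg n * (d / 2) <= sg n * (H s - mean_ b * G s) by rewrite ler_wpM2l//; lra.
have h3 : (sg n.+1 - sg n) * (mean_ b - mean_ s) <= (sg n.+1 - sg n) by rewrite ler_piMr//; lra.
lra.
Qed.

Lemma other_incentive s n a b : (s < K)%N -> (0 < s)%N -> (a < s)%N -> (b < K)%N ->
  other ar el s n = ar a ->
  0 <= Einst K P (fun mu => (1 - play mu s n) * (mu (ar a) - mu (ar b))).
Proof.
move=> sK s0 as_ bK oa; have aK := ltn_trans as_ sK.
case: n oa => [|n] /= oa.
  have el_s : (el s < s)%N by case: s s0 {sK as_ oa} => // s _; exact: el_lt.
  have ea : el s = a by apply: ar_inj oa => //; exact: ltn_trans el_s sK.
  rewrite [X in 0 <= X](_ : _ = Einst K P (fun mu =>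
    ((1 - sg 0) + (- (1 - sg 0)) * \prod_(l < K) wzero s l (mu (ar l))) * (mu (ar a) - mu (ar b)))); last first.
    congr Einst; apply/funext => mu; rewrite /play_law zprob_prod ?(ltnW sK)//; ring.
  rewrite Einst_gap//; last by move=> l; exact: bmeas_wz.
  have k1 := sg1 0.
  suff h : mean_ b - Uexp (wzero s) b <= mean_ a - Uexp (wzero s) a.
    rewrite mulNr -mulrBr mulr_ge0//; lra.
  rewrite -ea; have [bs|sb] := ltnP b s; first exact: el_max.
  (* An arm not yet reached contributes its prior mean times [1 - Zbar s] off the zeros event, which
     the first arm matches by [Uexp_wz_le]. *)
  apply: le_trans (el_max s0).
  rewrite Uexp_wz_ge//; have u := Uexp_wz_le s K0.
  have /andP[z0 z1] := Zbar01 s.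
  have hb := sorted (leq0n b) bK.
  have : mean_ b * (1 - Zbar s) <= mean_ 0 * (1 - Zbar s) by rewrite ler_wpM2r// subr_ge0.
  lra.
have a0 : a = 0%N by apply: ar_inj (esym oa).
rewrite a0 [X in 0 <= X](_ : _ = Einst K P (fun mu =>
    ((1 - (sg n.+1 - sg n)) + (- sg n) * \prod_(l < K) hgood s l (mu (ar l))) * (mu (ar 0) - mu (ar b)))); last first.
  congr Einst; apply/funext => mu; rewrite /play_law gprob_prod//; ring.
rewrite Einst_gap//; last by move=> l; exact: bmeas_hg.
rewrite !Uexp_hg//.
have -> : (0 == s)%N = false by case: (s) s0.
have st := sg_step n; have mo := sg_mono n; have gn := gain sK; have sn := sg0 n.
have s1 := sg1 n.+1.
have mt := mean_thr K0; have /andP[g0 g1] := G01 s.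
have /andP[? ?] := mean01 s; have /andP[? ?] := mean01 b.
have hb := sorted (leq0n b) bK.
have [bs|bs] := eqVneq b s.
  (* Passing the test is evidence for [ar s], so withholding it is evidence against it: the surplus
     now counts for the first arm. *)
  subst b; have h1 : mean_ 0 * G s <= thr * G s by rewrite ler_wpM2r.
  have h0 : 0 <= sg n * (d / 2) by lra.
  have h2 : sg n * (d / 2) <= sg n * (H s - mean_ 0 * G s) by rewrite ler_wpM2l//; lra.
  have h3 : 0 <= (1 - (sg n.+1 - sg n)) * (mean_ 0 - mean_ s) by rewrite mulr_ge0//; lra.
  lra.
(* The factor left over is the prior probability of withholding [ar s], at least [1 - sg n.+1]. *)
have -> : (1 - (sg n.+1 - sg n)) * (mean_ 0 - mean_ b) +
   - sg n * (mean_ 0 * G s - mean_ b * G s) =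
   (1 - (sg n.+1 - sg n) - sg n * G s) * (mean_ 0 - mean_ b) by ring.
have : sg n * G s <= sg n by rewrite ler_piMr.
by move=> ?; rewrite mulr_ge0//; lra.
Qed.

Lemma block_BIC :
  BIC K P (N * (K * M.+1)) (block_alg K N (slaw N M n0 ar el sg thr)).
Proof.
move=> t i j tT iK jK pr0.
have [a aK ea] := ar_surj iK; have [b bK eb] := ar_surj jK; subst i j.
rewrite /condRec; apply: divr_ge0; last exact: ltW.
pose bb := (t %/ N)%N; pose s := (bb %/ M.+1)%N; pose n := (bb %% M.+1)%N.
have bbK : (bb < K * M.+1)%N by rewrite ltn_divLR// mulnC.
have sK : (s < K)%N by rewrite ltn_divLR.
have nM : (n <= M)%N by rewrite -ltnS ltn_mod.
have et : t = (N * (s * M.+1 + n) + t %% N)%N by rewrite -divn_eq mulnC -divn_eq.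
have tN : (t %% N < N)%N by rewrite ltn_mod.
rewrite /Ejoint.
rewrite [X in 0 <= X](_ : _ = Einst K P (fun mu =>
   play mu s n * (if ar s == ar a then mu (ar a) - mu (ar b) else 0) +
   (1 - play mu s n) * (if other ar el s n == ar a then mu (ar a) - mu (ar b) else 0))); last first.
  congr Einst; apply/funext => mu.
  have e := @hist_exp_stage R K N M n0 ar el sg thr K0 N0 n0N arK ar_inj ar_surj el_lt el0 sg1
    sg_mono sgM mu s n (t %% N)%N (N * (K * M.+1))%N
    (fun x => if x == ar a then mu (ar a) - mu (ar b) else 0) sK nM tN.
  by rewrite -et in e; rewrite -(e tT).
(* In the opening stage both candidates are the first arm, which is therefore recommended with
   certainty. *)
have [s0|s0] := posnP s.
  have o0 : other ar el s n = ar 0 by rewrite s0; case: (n) => //=; rewrite el0.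
  rewrite o0 s0; case: eqP => [e|ne].
    have a0 : 0%N = a by apply: ar_inj e.
    rewrite -a0 [X in 0 <= X](_ : _ = Einst K P (fun mu =>
      (1 + 0 * \prod_(l < K) hgood s l (mu (ar l))) * (mu (ar 0) - mu (ar b)))); last first.
      by congr Einst; apply/funext => mu; ring.
    rewrite Einst_gap//; last by move=> l; exact: bmeas_hg.
    by rewrite mul0r addr0 mul1r subr_ge0; exact: sorted.
  rewrite [X in 0 <= X](_ : _ = Einst K P (fun mu =>
    (0 + 0 * \prod_(l < K) hgood s l (mu (ar l))) * (mu (ar a) - mu (ar b)))); last first.
    by congr Einst; apply/funext => mu; ring.
  rewrite Einst_gap//; last by move=> l; exact: bmeas_hg.
  by rewrite !mul0r addr0.
have [l0 l0s ol] : exists2 l0, (l0 < s)%N & other ar el s n = ar l0.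
  case: (n) => [|n'] /=; last by exists 0%N.
  by exists (el s) => //; case: (s) s0 => // s' _; exact: el_lt.
have [as_|nas] := eqVneq a s.
  subst a; have ne : (ar l0 == ar s) = false.
    by apply/eqP => /ar_inj e; have := e (ltn_trans l0s sK) sK; lia.
  rewrite eqxx ol ne.
  rewrite [X in 0 <= X](_ : _ = Einst K P (fun mu => play mu s n * (mu (ar s) - mu (ar b)))).
    exact: play_incentive.
  by congr Einst; apply/funext => mu; rewrite mulr0 addr0.
have -> : (ar s == ar a) = false.
  by apply/eqP => /ar_inj e; move: nas; rewrite (e sK aK) eqxx.
have [oa|noa] := eqVneq (other ar el s n) (ar a).
  rewrite [X in 0 <= X](_ : _ = Einst K P (fun mu => (1 - play mu s n) * (mu (ar a) - mu (ar b)))).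
    apply: other_incentive => //.
    suff <- : l0 = a by [].
    by apply: ar_inj => //; [exact: ltn_trans sK|rewrite -ol].
  by congr Einst; apply/funext => mu; rewrite mulr0 add0r.
rewrite [X in 0 <= X](_ : _ = Einst K P (fun mu =>
    (0 + 0 * \prod_(l < K) hgood s l (mu (ar l))) * (mu (ar a) - mu (ar b)))); last first.
  by congr Einst; apply/funext => mu; ring.
rewrite Einst_gap//; last by move=> l; exact: bmeas_hg.
by rewrite !mul0r addr0.
Qed.

End Incentives.

(** * Bounds on the Thompson sampling parameters *)

Section Thompson.
Context (R : realType).
Local Notation I01 := `[(0:R), 1]%classic.
Let mI : measurable I01. Proof. exact: measurable_itv. Qed.
Variables (K : nat) (P : nat -> probability R R) (phi d : R).
Hypotheses (P01 : forall i, (i < K)%N -> P i I01 = 1%E)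
  (phi0 : 0 <= phi) (mean_phi : forall i, (i < K)%N -> mean (P i) <= phi)
  (up : forall i, (i < K)%N -> d < Eone (P i) (fun x => Num.max (x - phi) 0))
  (low : forall i, (i < K)%N -> d <= Eone (P i) (fun x => Num.max (mean (P i) - x) 0))
  (d0 : 0 < d).

Let mC := @measurable_cube R.
Let LC : law P K (@cube R) = 1%E. Proof. exact: (law_cube P01 (leqnn K)). Qed.

(** The value [phi] itself counts as below, so one arm above and all others below gives a strict
    maximum and tie-breaking never matters. *)
Definition above (x : R) : R := if phi < x then 1 else 0.
Definition below (x : R) : R := if x <= phi then 1 else 0.

Lemma bmeas_above : bmeas I01 above.
Proof.
apply: bmeas_ind; suff -> : [set x : R | phi < x] = `]phi, +oo[%classic by exact: measurable_itv.
by apply/seteqP; split => x /=; rewrite in_itv /= andbT.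
Qed.

Lemma bmeas_below : bmeas I01 below.
Proof.
apply: bmeas_ind; suff -> : [set x : R | x <= phi] = `]-oo, phi]%classic by exact: measurable_itv.
by apply/seteqP; split => x /=; rewrite in_itv.
Qed.

Lemma above_gt i : (i < K)%N -> d < Eone (P i) above.
Proof.
move=> iK; apply: lt_le_trans (up iK) _.
have pp := phi0.
apply: (Exp_le mI (P01 iK) (bmeas_pos phi) bmeas_above) => x /I01P/andP[x0 x1].
by rewrite /above maxEle; case: ifP; case: ifP; lra.
Qed.

Lemma below_ge i : (i < K)%N -> d <= Eone (P i) below.
Proof.
move=> iK; apply: le_trans (low iK) _; have mp := mean_phi iK.
have m1 := mean_le1 (P01 iK).
apply: (Exp_le mI (P01 iK) (bmeas_neg _) bmeas_below) => x /I01P/andP[x0 x1].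
by rewrite /below maxEle; case: ifP; case: ifP; lra.
Qed.

(** Restrict to the event mu_i > phi: by independence and the bound of the mean of arm [j] by [phi],
    what is left is at least E[(mu_i - phi)_+]. *)
Lemma eps_TS_ge : (1 < K)%N -> d <= eps_TS K P.
Proof.
move=> K1; apply: lb_le_inf.
  by exists (Einst K P (fun mu => Num.max (mu 0%N - mu 1%N) 0)), 0%N, 1%N; split => //; exact: ltnW.
move=> _ [i [j [iK jK ij ->]]]; apply: ltW.
pose h l (x : R) := if l == i then above x else 1.
have bh l : bmeas I01 (h l).
  by rewrite /h; case: eqP => _; [exact: bmeas_above|exact: bmeas_cst].
have bc k : bmeas (@cube R) (fun mu : seqT R => mu k) by exact: (bmeas_coord k (bmeas_id R)).
have bp : bmeas (@cube R) (fun mu : seqT R => \prod_(l < K) h l (mu l)).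
  by apply: bmeas_prod => l _; exact: bmeas_coord.
have b1 : bmeas (@cube R) (fun mu : seqT R => (0 + 1 * \prod_(l < K) h l (mu l)) * (mu i - mu j)).
  apply: bmeasM; last exact: bmeasB.
  by apply: bmeasD; [exact: bmeas_cst|exact: bmeasZ].
apply: (@lt_le_trans _ _ (Einst K P (fun mu => (0 + 1 * \prod_(l < K) h l (mu l)) * (mu i - mu j)))); last first.
  rewrite !(EinstE P01)//; last by apply: bmeas_max; [exact: bmeasB|exact: bmeas_cst].
  apply: (Exp_le mC LC) => //; first by apply: bmeas_max; [exact: bmeasB|exact: bmeas_cst].
  move=> mu _; rewrite (bigD1 (Ordinal iK)) //= big1 => [|l]; last first.
    by rewrite -(inj_eq val_inj) /= /h => /negbTE ->.
  rewrite /h eqxx mulr1 mul1r add0r /above; case: ifP => _; last by rewrite mul0r le_max lexx orbT.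
  by rewrite mul1r le_max lexx.
(* [Einst_gap] expects an order whose values are arms at every index, hence the truncated
   identity. *)
pose ar l := if (l < K)%N then l else 0%N.
have arE l : (l < K)%N -> ar l = l by rewrite /ar => ->.
have arK l : (ar l < K)%N by rewrite /ar; case: ifP => // _; exact: ltnW.
have ar_inj a b : (a < K)%N -> (b < K)%N -> ar a = ar b -> a = b by move=> aK bK; rewrite !arE.
have ar_surj a : (a < K)%N -> exists2 l, (l < K)%N & ar l = a.
  by move=> aK; exists a => //; exact: arE.
have := @Einst_gap R K P ar P01 arK ar_inj ar_surj h i j 0 1 iK jK bh.
rewrite !arE// [X in Einst _ _ X](_ : _ =
    fun mu : nat -> R => (0 + 1 * \prod_(l < K) h l (mu l)) * (mu i - mu j)); last first.
  by apply/funext => mu; congr ((_ + _ * _) * _); apply: eq_bigr => l _; rewrite arE.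
move=> ->; rewrite mul0r add0r mul1r /Uexp !arE//.
rewrite [X in _ < _ * X - _](eq_bigr (fun l : 'I_K => Eone (P l) (h l))); last first.
  by move=> l _; rewrite arE.
rewrite [X in _ < _ - _ * X](eq_bigr (fun l : 'I_K => Eone (P l) (h l))); last first.
  by move=> l _; rewrite arE.
have e1 l : l != i -> Eone (P l) (h l) = 1.
  by rewrite /h => /negbTE ->; exact: (Exp_cst (P l) 1).
rewrite [X in _ < _ * X - _]big1 => [|l]; last by move=> li; exact: e1.
rewrite mulr1 [X in _ < _ - _ * X](bigD1 (Ordinal iK)) /=; last exact/eqP.
rewrite big1 => [|l]; last first.
  by rewrite -(inj_eq val_inj) /= => /andP[_ li]; exact: e1.
rewrite mulr1 [h i](_ : _ = above); last by apply/funext => x; rewrite /h eqxx.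
have -> : Eone (P j) (fun x => x * h j x) = mean (P j).
  congr Eone; apply/funext => x; rewrite /h ifF ?mulr1//.
  by apply/eqP => e; apply: ij.
apply: lt_le_trans (up iK) _.
have bxa : bmeas I01 (fun x : R => x * above x).
  by apply: bmeasM; [exact: bmeas_id|exact: bmeas_above].
rewrite -(ExpZ mI (P01 iK) _ bmeas_above) -(ExpB mI (P01 iK) bxa (bmeasZ _ bmeas_above)).
apply: (Exp_le mI (P01 iK) (bmeas_pos phi)).
  by apply: bmeasB => //; apply: bmeasZ; exact: bmeas_above.
move=> x /I01P/andP[x0 x1]; have mp := mean_phi jK.
by rewrite /above maxEle; case: ifP; case: ifP; lra.
Qed.

Lemma bmeas_cmp (i j : nat) :
  bmeas (@cube R) (fun mu : seqT R => if mu i <= mu j then 1 else 0 : R) /\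
  bmeas (@cube R) (fun mu : seqT R => if mu i < mu j then 1 else 0 : R).
Proof.
have mi := @measurable_coord R i; have mj := @measurable_coord R j.
split; apply: bmeas_ind.
  rewrite [X in measurable X](_ : _ = setT `&` (fun mu : seqT R => (mu i : R) <= mu j) @^-1` [set true]).
    exact: (measurable_fun_ler mi mj).
  by rewrite setTI.
rewrite [X in measurable X](_ : _ = setT `&` (fun mu : seqT R => (mu i : R) < mu j) @^-1` [set true]).
  exact: (measurable_fun_ltr mi mj).
by rewrite setTI.
Qed.

(** Arm [i] above [phi] and all others below is a product event that forces A* = i, and each of its
    [K] factors is at least [d]. *)
Lemma delta_TS_ge : (0 < K)%N -> d ^+ K <= delta_TS K P.
Proof.
move=> K0; apply: lb_le_inf.
  by exists (Einst K P (fun mu => if `[< is_Astar K mu 0 >] then 1 else 0)), 0%N.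
move=> _ [i [iK ->]].
pose h l (x : R) := if l == i then above x else below x.
have bh l : bmeas I01 (h l).
  by rewrite /h; case: eqP => _; [exact: bmeas_above|exact: bmeas_below].
have bp : bmeas (@cube R) (fun mu : seqT R => \prod_(l < K) h l (mu l)).
  by apply: bmeas_prod => l _; exact: bmeas_coord.
apply: (@le_trans _ _ (Einst K P (fun mu => \prod_(l < K) h l (mu l)))).
  rewrite (Einst_prod P01)//.
  rewrite -[X in d ^+ X]card_ord -prodr_const; apply: ler_prod => l _.
  rewrite ltW //= /h; case: eqP => [->|_]; [exact/ltW/above_gt|exact: below_ge].
have bA : bmeas (@cube R) (fun mu : seqT R => if `[< is_Astar K mu i >] then 1 else 0 : R).
  rewrite [X in bmeas _ X](_ : _ = fun mu : seqT R =>
     (\prod_(j < K) (if mu j <= mu i then 1 else 0)) * (\prod_(j < i) (if mu j < mu i then 1 else 0))).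
    by apply: bmeasM; apply: bmeas_prod => j _; [have [] := bmeas_cmp j i|have [] := bmeas_cmp j i].
  apply/funext => mu; case: asboolP => [[h1 h2]|h3].
    by rewrite !big1 ?mulr1// => j _; [rewrite h2|rewrite h1].
  apply/esym/eqP; rewrite mulf_eq0; apply/negPn/negP; rewrite negb_or => /andP[h1 h2].
  apply: h3; split => j jK.
    rewrite leNgt; apply/negP => lt; move/negP: h1; apply; apply/eqP.
    by rewrite (bigD1 (Ordinal jK)) //= leNgt lt /= mul0r.
  rewrite ltNge; apply/negP => le; move/negP: h2; apply; apply/eqP.
  by rewrite (bigD1 (Ordinal jK)) //= ltNge le /= mul0r.
rewrite !(EinstE P01)//; apply: (Exp_le mC LC) => // mu _.
have hle l (x : R) : 0 <= h l x <= 1.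
  by rewrite /h /above /below; case: eqP => _; case: ifP => _; rewrite ?lexx ?ler01.
case: asboolP => [_|nA]; first by apply: Num.Theory.prodr_ile1 => l _.
suff -> : \prod_(l < K) h l (mu l) = 0 by [].
apply/eqP/negPn/negP => nz; apply: nA.
have nz' l : (l < K)%N -> h l (mu l) != 0.
  by move=> lK; move/prodf_neq0: nz => /(_ (Ordinal lK) isT).
have hi : phi < mu i.
  by have := nz' i iK; rewrite /h eqxx /above; case: ifP; rewrite ?eqxx.
have hj j : (j < K)%N -> j != i -> mu j <= phi.
  by move=> jK ji; have := nz' j jK; rewrite /h (negbTE ji) /below; case: ifP; rewrite ?eqxx.
split=> j jK.
  by have [->|ji] := eqVneq j i; [|apply: le_trans (ltW hi); exact: hj].
apply: le_lt_trans hi; apply: hj; first exact: ltn_trans iK.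
by rewrite neq_ltn jK.
Qed.

Lemma N_TS_le (c : R) : 0 <= c -> (1 < K)%N -> d < 1 ->
  N_TS c K P <= c * d ^- 2 * (K%:R * ln (4 / d)).
Proof.
move=> c0 K1 d1; have K0 := ltnW K1; have dd := d0; rewrite /N_TS.
have he := eps_TS_ge K1; have hd := delta_TS_ge K0.
have dK : 0 < d ^+ K by rewrite exprn_gt0.
have del0 : 0 < delta_TS K P by exact: lt_le_trans hd.
have e0 : 0 < eps_TS K P by exact: lt_le_trans he.
have l4 : 0 <= ln (4 / d) by rewrite ln_ge0// ler_pdivlMr//; lra.
have hl : ln ((delta_TS K P)^-1) <= K%:R * ln (4 / d).
  apply: (@le_trans _ _ (ln ((d ^+ K)^-1))).
    by rewrite ler_ln ?posrE ?invr_gt0// lef_pV2 ?posrE.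
  rewrite -exprVn lnXn ?invr_gt0// -[leLHS]mulr_natl ler_wpM2l//.
  rewrite ler_ln ?posrE ?invr_gt0 ?divr_gt0// ler_peMl ?invr_ge0//; lra.
apply: (@le_trans _ _ (c * eps_TS K P ^- 2 * (K%:R * ln (4 / d)))).
  by rewrite ler_wpM2l// mulr_ge0// invr_ge0 exprn_ge0// ltW.
rewrite ler_wpM2r ?mulr_ge0// ler_wpM2l// lef_pV2 ?posrE ?exprn_gt0//.
by apply: lerXn2r; rewrite ?nnegrE// ltW.
Qed.

End Thompson.

(** * Number of rounds *)

Lemma expR_le_1D2 (R : realType) (y : R) : 0 <= y -> y <= 1 / 2 -> expR y <= 1 + 2 * y.
Proof.
move=> y0 y1; have h : 1 - y <= expR (- y) by have := expR_ge1Dx (- y); lra.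
have y2 : 0 < 1 - y by lra.
apply: (@le_trans _ _ (1 - y)^-1).
  by rewrite -[expR y]invrK -expRN lef_pV2 ?posrE ?expR_gt0.
rewrite -[X in X <= _]mul1r ler_pdivrMr//.
have : 0 <= y * (1 - 2 * y) by rewrite mulr_ge0//; lra.
lra.
Qed.

Lemma pow_1D_ge (R : realType) (d X : R) (n : nat) : 0 < d -> d <= 1 -> 0 < X ->
  4 / d * ln X <= n%:R -> X <= (1 + d / 2) ^+ n.
Proof.
move=> d0 d1 X0 hn.
have h : expR (d / 4) <= 1 + d / 2.
  by apply: le_trans (expR_le_1D2 _ _) _; lra.
apply: (@le_trans _ _ (expR (d / 4) ^+ n)); last first.
  by apply: lerXn2r; rewrite ?nnegrE ?expR_ge0//; lra.
rewrite -expRM_natl -{1}(lnK (X0 : X \is Num.pos)) ler_expR.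
have -> : ln X = (4 / d * ln X) * (d / 4) by field; rewrite gt_eqF.
by rewrite ler_wpM2r//; lra.
Qed.

Lemma nat_argmax (R : realType) (V : nat -> R) (s : nat) :
  exists2 e, (e < s.+1)%N & forall l, (l < s.+1)%N -> V l <= V e.
Proof.
elim: s => [|s [e es he]]; first by exists 0%N => // l; rewrite ltnS leqn0 => /eqP ->.
have [h|h] := leP (V e) (V s.+1).
  exists s.+1 => // l; rewrite ltnS leq_eqVlt => /predU1P[->//|ls].
  by apply: le_trans h; exact: he.
exists e; first exact: ltnW.
move=> l; rewrite ltnS leq_eqVlt => /predU1P[->|ls]; [exact: ltW|exact: he].
Qed.

(** Instances come in arbitrary order, while the stages need decreasing prior means. The default 0
    of [nth] keeps [ar] among the arms at every index. *)
Lemma sorting_order (R : realType) (K : nat) (f : nat -> R) : (0 < K)%N ->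
  exists ar : nat -> nat, [/\ forall s, (ar s < K)%N,
    forall i j, (i < K)%N -> (j < K)%N -> ar i = ar j -> i = j,
    forall a, (a < K)%N -> exists2 l, (l < K)%N & ar l = a &
    forall i j, (i <= j)%N -> (j < K)%N -> f (ar j) <= f (ar i)].
Proof.
move=> K0; pose leT i j := f j <= f i.
pose o := sort leT (iota 0 K).
have so : size o = K by rewrite size_sort size_iota.
have mo a : (a \in o) = (a < K)%N by rewrite mem_sort mem_iota.
have uo : uniq o by rewrite sort_uniq iota_uniq.
exists (nth 0%N o); split.
- move=> s; have [sK|Ks] := ltnP s K; first by rewrite -mo mem_nth// so.
  by rewrite nth_default// so.
- by move=> i j iK jK /eqP; rewrite nth_uniq ?so// => /eqP.
- move=> a; rewrite -mo => ao; exists (index a o); first by rewrite -so index_mem.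
  exact: nth_index.
move=> i j ij jK.
have tr : transitive leT by move=> y x z h1 h2; exact: le_trans h2 h1.
have rl : reflexive leT by move=> x; exact: lexx.
have st : sorted leT o by apply: sort_sorted => x y; exact: le_total.
by apply: (sorted_leq_nth tr rl 0%N st) => //; rewrite inE so//; exact: leq_ltn_trans jK.
Qed.

(** * The algorithm for easy collections *)

Section EasyInstance.
Context (R : realType).
Local Notation I01 := `[(0:R), 1]%classic.
Let mI : measurable I01. Proof. exact: measurable_itv. Qed.

(** The factors of the arms other than [ar a] are common to both terms, so the difference is a
    product of [K] factors, each at least (d/4)^(n0+1). Only the logarithm of this bound enters the
    number of rounds. *)
Lemma easy_margin (K n0 : nat) (P : nat -> probability R R) (ar : nat -> nat) (d : R) s a :
  (forall l, P (ar l) I01 = 1%E) -> 0 < d -> d <= 1 ->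
  (forall l, (l < K)%N ->
     d <= Eone (P (ar l)) (fun x => Num.max (mean (P (ar s)) - x) 0)) ->
  4 / d <= (1 + d / 2) ^+ n0 -> (a < s)%N -> (s < K)%N ->
  ((d / 4) ^+ n0.+1) ^+ K <=
    mean (P (ar s)) * Zbar K n0 P ar s - Uexp K P ar (wzero n0 s) a.
Proof.
move=> PA d0 d1 low hn as_ sK; have aK := ltn_trans as_ sK.
set q := (d / 4) ^+ n0.+1; set m := mean _.
have q0 : 0 <= q by apply: exprn_ge0; lra.
have q1 : q <= 1 by apply: exprn_ile1; lra.
have dd : (d / 4) ^+ n0 <= (d / 2) ^+ n0 by apply: lerXn2r; rewrite ?nnegrE; lra.
have dn : 0 <= (d / 2) ^+ n0 by apply: exprn_ge0; lra.
have m0 : 0 <= m by exact: mean_ge0.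
have m1 : m <= 1 by exact: mean_le1.
have Wq l : (l < K)%N -> q <= Eone (P (ar l)) (wzero n0 s l).
  move=> lK; rewrite /wzero; case: ltnP => ls; last by rewrite [X in _ <= X](Exp_cst (P (ar l)) 1).
  apply: le_trans (onem_exp_lower (PA l) d0 m1 (low l lK) n0).
  rewrite /q exprSr; apply: ler_pM => //; [by apply: exprn_ge0; lra|lra|lra].
rewrite /Zbar (bigD1 (Ordinal aK)) //= /Uexp mulrA -mulrBl.
set Y := \prod_(i < K | _) _.
have ew : wzero n0 s a = (fun x : R => (1 - x) ^+ n0) by apply/funext => x; rewrite /wzero as_.
have bX := bmeas_onem_exp R n0.
have bxX : bmeas I01 (fun x : R => x * (1 - x) ^+ n0) by apply: bmeasM => //; exact: bmeas_id.
have gap : q <= m * Eone (P (ar a)) (wzero n0 s a) - Eone (P (ar a)) (fun x => x * wzero n0 s a x).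
  rewrite ew -(ExpZ mI (PA a) _ bX) -(ExpB mI (PA a) (bmeasZ _ bX) bxX).
  have h := @gap_onem_exp R (P (ar a)) (PA a) d m d0 m0 m1 (low a aK) n0.
  apply: le_trans (le_trans (h _) _); last 1 first.
  - rewrite le_eqVlt; apply/orP; left; apply/eqP; congr Eone; apply/funext => x.
    by rewrite mulrBl.
  - by rewrite /q exprS ler_wpM2l//; lra.
  (* This turns the condition of [gap_onem_exp], which involves the mean, into the uniform condition
     on [n0]. *)
  have e1 : (1 - m) * (1 + d / 2) <= 1 - m + d / 2.
    have : 0 <= m * (d / 2) by rewrite mulr_ge0//; lra.
    lra.
  have e2 : ((1 - m) * (1 + d / 2)) ^+ n0 <= (1 - m + d / 2) ^+ n0.
    by apply: lerXn2r; rewrite ?nnegrE//; [apply: mulr_ge0; lra|lra].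
  rewrite exprMn in e2.
  have mn : 0 <= (1 - m) ^+ n0 by apply: exprn_ge0; lra.
  have e3 : (1 - m) ^+ n0 * (4 / d) <= (1 - m) ^+ n0 * (1 + d / 2) ^+ n0 by rewrite ler_wpM2l.
  have e4 : d / 4 * ((1 - m) ^+ n0 * (4 / d)) <= d / 4 * (1 - m + d / 2) ^+ n0.
    by rewrite ler_wpM2l//; lra.
  have <- // : d / 4 * ((1 - m) ^+ n0 * (4 / d)) = (1 - m) ^+ n0.
  by field; rewrite gt_eqF.
rewrite -[X in q ^+ X]card_ord -prodr_const (bigD1 (Ordinal aK)) //=.
apply: ler_pM => //; first by apply: prodr_ge0.
by apply: ler_prod => l _; rewrite q0 Wq.
Qed.

Lemma easy_algorithm (K N M n0 : nat) (P : nat -> probability R R) (phi d Ns : R) :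
  (1 < K)%N -> 0 < d -> d <= 1 -> 0 <= phi ->
  (forall i, (i < K)%N -> P i I01 = 1%E) ->
  (forall i, (i < K)%N -> mean (P i) <= phi) ->
  (forall i, (i < K)%N -> d < Eone (P i) (fun x => Num.max (x - phi) 0)) ->
  (forall i j, (i < K)%N -> (j < K)%N ->
     d <= Eone (P i) (fun x => Num.max (mean (P j) - x) 0)) ->
  (0 < N)%N -> (n0 <= N)%N -> 1 <= N%:R * d ^+ 2 -> Ns <= N%:R ->
  4 / d <= (1 + d / 2) ^+ n0 ->
  2 / ((d / 4) ^+ n0.+1) ^+ K <= (1 + d / 2) ^+ M ->
  exists alg, [/\ valid_alg K alg, BIC K P (N * (K * M.+1)) alg &
     collects K P (N * (K * M.+1)) alg Ns].
Proof.
move=> K1 d0 d1 phi0 P01 mphi up low N0 n0N Nd NsN hn0 hM.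
have K0 := ltnW K1.
have [ar [arK ar_inj ar_surj srt]] := sorting_order (fun i => mean (P i)) K0.
have PA l : P (ar l) I01 = 1%E by apply: P01; exact: arK.
(* The maximized quantity is E[mu_l (1 - Z)], with Z the likelihood of the zeros event: the best
   earlier arm when zeros fail. *)
have /choice[el hel] s : exists e, (if s is s'.+1 then (e < s)%N else e = 0%N) /\
    forall l, (l < s)%N -> mean (P (ar l)) - Uexp K P ar (wzero n0 s) l <=
      mean (P (ar e)) - Uexp K P ar (wzero n0 s) e.
  case: s => [|s]; first by exists 0%N.
  have [e es he] := nat_argmax (fun l => mean (P (ar l)) - Uexp K P ar (wzero n0 s.+1) l) s.
  by exists e.
have el_lt s : (el s.+1 < s.+1)%N by have [] := hel s.+1.
have el0 : el 0 = 0%N by have [] := hel 0%N.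
have el_max s l : (l < s)%N -> mean (P (ar l)) - Uexp K P ar (wzero n0 s) l <=
    mean (P (ar (el s))) - Uexp K P ar (wzero n0 s) (el s).
  by have [_] := hel s; exact.
set q := ((d / 4) ^+ n0.+1) ^+ K in hM.
have q0 : 0 < q by apply: exprn_gt0; apply: exprn_gt0; lra.
have q1 : q <= 1.
  by apply: exprn_ile1; [apply: exprn_ge0; lra|apply: exprn_ile1; lra].
(* Half of the margin [q] is what the opening block can afford, and [r] is the largest growth rate
   that [sg_step] allows. *)
pose kap := q / 2; pose r := 1 + d / 2.
pose sg n := Num.min 1 (kap * r ^+ n).
have kr n : 0 <= kap * r ^+ n.
  by apply: mulr_ge0; [rewrite /kap; lra|apply: exprn_ge0; rewrite /r; lra].
have sg0 n : 0 <= sg n by rewrite /sg le_min ler01 kr.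
have sg1 n : sg n <= 1 by rewrite /sg ge_min lexx.
have krS n : kap * r ^+ n.+1 = kap * r ^+ n + kap * r ^+ n * (d / 2).
  by rewrite exprSr /r; ring.
have krd n : 0 <= kap * r ^+ n * (d / 2) by apply: mulr_ge0 => //; lra.
have sg_mono n : sg n <= sg n.+1.
  by rewrite /sg le_min !ge_min lexx /= krS lerDl krd orbT.
have sg_step n : sg n.+1 - sg n <= sg n * (d / 2).
  have [h|h] := leP 1 (kap * r ^+ n).
    have -> : sg n = 1 by rewrite /sg; exact/min_idPl.
    by have := sg1 n.+1; lra.
  have -> : sg n = kap * r ^+ n by rewrite /sg; apply/min_idPr; exact: ltW.
  have : sg n.+1 <= kap * r ^+ n.+1 by rewrite /sg ge_min lexx orbT.
  by rewrite krS; lra.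
have sgM : sg M = 1.
  rewrite /sg; apply/min_idPl.
  have : kap * (2 / q) <= kap * r ^+ M by rewrite ler_wpM2l// /kap; lra.
  by have -> : kap * (2 / q) = 1 by rewrite /kap; field; rewrite gt_eqF.
have sgE0 : 2 * sg 0 <= q.
  have : sg 0 <= kap * r ^+ 0 by rewrite /sg ge_min lexx orbT.
  by rewrite expr0 mulr1 /kap; lra.
exists (block_alg K N (slaw N M n0 ar el sg phi)); split.
- exact: (valid_stage_alg N M n0 el phi K0 arK sg0 sg1 sg_mono).
- apply: (@block_BIC R K N M n0 P ar el sg phi d) => //.
  + by move=> s sK; exact: mphi.
  + by move=> s sK; apply: good_gain => //; exact: up.
  move=> s a as_ sK; apply: le_trans sgE0 _.
  by apply: (@easy_margin K n0 P ar d s a) => // l lK; apply: low.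
rewrite /collects /Ejoint.
rewrite [X in Einst _ _ X](_ : _ = fun=> 1).
  have b1 : bmeas (@cube R) (fun=> 1 : R) by exact: bmeas_cst.
  by rewrite (EinstE P01 b1) Exp_cst.
apply/funext => mu.
apply: (@hist_exp_collect R K N M n0 ar el sg phi K0 N0 n0N arK ar_inj ar_surj el_lt el0 sgM mu) => h hh.
rewrite ifT//; apply/allP => a; rewrite mem_iota /= add0n => aK.
apply: le_trans NsN _; rewrite ler_nat; apply: leq_trans (hh a aK) _.
by rewrite /obs size_map size_filter.
Qed.

End EasyInstance.

Lemma nat_ceil (R : realType) (x : R) : 0 <= x ->
  exists n : nat, [/\ (0 < n)%N, x <= n%:R & n%:R <= x + 1].
Proof.
move=> x0; exists (Num.truncn x).+1; split=> //; first by rewrite ltW// truncnS_gt.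
by rewrite -natr1 lerD2r truncn_le.
Qed.

(** With u = 1/d and l = ln(K/d + 3): [n0] is O(u l), ln(2/q) is O(K u l^2), [M] is O(K u^2 l^2) and
    [N] is O(K u^2 l), for fixed [c]. *)
Lemma round_count (R : realType) (c d : R) (K : nat) : 0 <= c -> 0 < d -> d < 1 -> (1 < K)%N ->
  exists N M n0 : nat,
    [/\ [/\ (0 < N)%N, (n0 <= N)%N, 1 <= N%:R * d ^+ 2 &
         c * d ^- 2 * (K%:R * ln (4 / d)) <= N%:R],
        4 / d <= (1 + d / 2) ^+ n0,
        2 / ((d / 4) ^+ n0.+1) ^+ K <= (1 + d / 2) ^+ M &
        (N * (K * M.+1))%:R <=
          86 * (2 * c + 12) * (K%:R ^+ 3 / d ^+ 4) * ln (K%:R / d + 3) ^+ 3].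
Proof.
move=> c0 d0 d1 K1; set k : R := K%:R; set L := ln (4 / d); set l := ln (k / d + 3).
have k2 : 2 <= k by rewrite ler_nat.
pose u := d^-1; have u1 : 1 <= u by rewrite /u invf_ge1// ltW.
have du : d * u = 1 by rewrite /u mulfV// gt_eqF.
have kd : k / d = k * u by [].
have ku : 2 <= k * u by have := ler_pM (ler0n _ 2) ler01 k2 u1; rewrite mulr1.
have uu : u <= k * u by rewrite ler_peMl//; lra.
(* The summand 3 keeps the logarithm at least 1, so that powers of [l] absorb additive constants. *)
have l1 : 1 <= l.
  rewrite -(expRK 1) /l ler_ln ?posrE ?expR_gt0//; last by rewrite -/u; lra.
  have h : expR (1 / 2) <= 2 :> R by apply: le_trans (expR_le_1D2 _ _) _; lra.
  have -> : (1 : R) = 1 / 2 + 1 / 2 by lra.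
  rewrite expRD; have := ler_pM (expR_ge0 _) (expR_ge0 _) h h; rewrite -/u; lra.
have Ll : L <= 2 * l.
  have -> : 2 * l = ln ((k * u + 3) ^+ 2).
    by rewrite lnXn; [rewrite mulr_natl|lra].
  rewrite /L ler_ln ?posrE ?exprn_gt0 ?divr_gt0//; try by rewrite -/u; lra.
  rewrite -/u expr2.
  have : 0 <= (k * u) * (k * u) by rewrite mulr_ge0//; lra.
  lra.
have L0 : 0 <= L by rewrite /L ln_ge0// -/u; lra.
have uL0 : 0 <= 4 * u * L by rewrite mulr_ge0//; lra.
have [n0 [_ n0l n0u]] := nat_ceil uL0.
have ul : 1 <= u * l by have := ler_pM ler01 ler01 u1 l1; rewrite mulr1.
have uL : u * L <= 2 * (u * l).
  have : u * L <= u * (2 * l) by rewrite ler_wpM2l//; lra.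
  lra.
have n0b : n0.+1%:R <= 10 * (u * l) by rewrite -natr1; lra.
set q := ((d / 4) ^+ n0.+1) ^+ K.
have q0 : 0 < q by rewrite !exprn_gt0// divr_gt0.
have lnq : ln (2 / q) = ln 2 + k * (n0.+1%:R * L).
  rewrite lnM ?posrE ?invr_gt0//; congr (_ + _).
  rewrite /q -!exprVn invf_div lnXn ?exprn_gt0 ?divr_gt0// lnXn ?divr_gt0//.
  by rewrite /k [RHS]mulr_natl [n0.+1%:R * L]mulr_natl.
have ln2 : ln 2 <= 1 :> R.
  rewrite -[X in _ <= X](expRK 1) ler_ln ?posrE ?expR_gt0//.
  have := expR_ge1Dx (1 : R); lra.
have ll : l <= l * l by rewrite ler_peMl//; lra.
have Lq : ln (2 / q) <= 21 * (k * u * (l * l)).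
  rewrite lnq.
  have h1 : n0.+1%:R * L <= 10 * (u * l) * (2 * l) by rewrite ler_pM.
  have h2 : k * (n0.+1%:R * L) <= k * (10 * (u * l) * (2 * l)) by rewrite ler_wpM2l//; lra.
  have h3 : 1 * 1 <= k * u * (l * l) by apply: ler_pM => //; lra.
  have h4 : k * (10 * (u * l) * (2 * l)) = 20 * (k * u * (l * l)) by ring.
  lra.
have Lq0 : 0 <= ln (2 / q).
  by rewrite lnq; apply: addr_ge0; [rewrite ln_ge0//; lra|rewrite !mulr_ge0//; lra].
have uLq0 : 0 <= 4 * u * ln (2 / q) by rewrite mulr_ge0//; lra.
have [M [_ Ml Mu]] := nat_ceil uLq0.
have Mb : M.+1%:R <= 86 * (k * u ^+ 2 * (l * l)).
  have h1 : 4 * u * ln (2 / q) <= 4 * u * (21 * (k * u * (l * l))) by rewrite ler_wpM2l//; lra.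
  have h2 : 4 * u * (21 * (k * u * (l * l))) = 84 * (k * u ^+ 2 * (l * l)) by ring.
  have h3 : 1 * 1 <= k * u ^+ 2 * (l * l).
    apply: ler_pM => //; last lra.
    have -> : k * u ^+ 2 = (k * u) * u by ring.
    by have := ler_pM ler01 ler01 (_ : 1 <= k * u) u1; rewrite mulr1; apply; lra.
  by rewrite -natr1; lra.
pose A := c * d ^- 2 * (k * L).
have A0 : 0 <= A by rewrite !mulr_ge0// ?invr_ge0 ?exprn_ge0//; lra.
pose B := d ^- 2; have Bu : B = u ^+ 2 by rewrite /B exprVn.
have B0 : 0 <= B by rewrite Bu exprn_ge0//; lra.
have [nA [nA0 Al Au]] := nat_ceil A0.
have [nB [_ Bl Bu1]] := nat_ceil B0.
have Nb : (nA + nB + n0)%:R <= (2 * c + 12) * (k * u ^+ 2 * l).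
  have h3 : A <= 2 * c * (k * u ^+ 2 * l).
    have -> : 2 * c * (k * u ^+ 2 * l) = c * u ^+ 2 * (k * (2 * l)) by ring.
    rewrite /A -/B Bu; apply: ler_wpM2l; first by rewrite mulr_ge0// -Bu.
    by apply: ler_wpM2l => //; lra.
  have h4 : u * l <= k * u ^+ 2 * l.
    apply: ler_wpM2r; first exact: le_trans ler01 l1.
    have -> : k * u ^+ 2 = u * (k * u) by ring.
    by apply: ler_peMr; [exact: le_trans ler01 u1|apply: le_trans ku; rewrite ler1n].
  have h5 : B <= k * u ^+ 2 * l.
    rewrite Bu; have h : u ^+ 2 * 1 <= u ^+ 2 * (k * l).
      apply: ler_wpM2l; first by rewrite -Bu.
      by have k1 : 1 <= k by [lra]; have := ler_pM ler01 ler01 k1 l1; rewrite mulr1.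
    have e : k * u ^+ 2 * l = u ^+ 2 * (k * l) by ring.
    lra.
  by rewrite !natrD; lra.
(* The three summands of [N] meet its three demands: enough samples, a reliable test, and room for
   the zeros. *)
exists (nA + nB + n0)%N, M, n0; split; first split.
- by rewrite !addn_gt0 nA0.
- by rewrite leq_addl.
- rewrite [leLHS](_ : 1 = B * d ^+ 2); last by rewrite /B mulVf// expf_neq0// gt_eqF.
  rewrite ler_wpM2r ?exprn_ge0 ?(ltW d0)//; apply: le_trans Bl _.
  by rewrite ler_nat addnAC leq_addl.
- by apply: le_trans Al _; rewrite ler_nat -addnA leq_addr.
- by apply: pow_1D_ge => //; [exact: ltW|rewrite divr_gt0].
- by apply: pow_1D_ge => //; [exact: ltW|rewrite divr_gt0].
rewrite !natrM -/k.
have h1 : k * M.+1%:R <= k * (86 * (k * u ^+ 2 * (l * l))) by apply: ler_wpM2l.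
apply: le_trans (ler_pM (ler0n _ _) (mulr_ge0 (ler0n _ _) (ler0n _ _)) Nb h1) _.
rewrite le_eqVlt; apply/orP; left; apply/eqP.
have -> : k ^+ 3 / d ^+ 4 = k ^+ 3 * u ^+ 4 by rewrite /u exprVn.
ring.
Qed.

Theorem theorem5p4 (R : realType) :
  (* (a) *)
  (exists CTS0 : R, forall CTS : R, CTS0 <= CTS ->
    exists (C0 : R) (k0 : nat),
    forall (C : set (probability R R)) (d : R),
      dist01 C -> 0 < d -> easy C d -> nondominant C d ->
      forall (K : nat) (P : nat -> probability R R),
        (2 <= K)%N -> consistent C K P ->
        exists (T : nat) (alg : history -> nat -> R),
          [/\ valid_alg K alg, BIC K P T alg,
              T%:R <= C0 * (K%:R ^+ 3 / d ^+ 4) * (ln (K%:R / d + 3)) ^+ k0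
            & collects K P T alg (N_TS CTS K P)])
  /\
  (* (b) *)
  (forall d : R, 0 < d -> exists c : R, 0 < c /\
    forall C : set (probability R R), dist01 C -> hard C d ->
      exists K0 : nat, forall K : nat, (K0 <= K)%N ->
        exists P : nat -> probability R R,
          [/\ consistent C K P, sorted_inst K P &
              ((expR (c * K%:R))%:E < RLB K P)%E])
  /\
  (* final claim *)
  (forall C : set (probability R R), dist01 C -> finite_set C ->
     min_supp C <> Phi C ->
     exists d : R, 0 < d /\ (easy C d \/ hard C d)).
Proof.
split; last split.
(* Every nonnegative [CTS] is admissible. The exponent 3 counts one logarithm in [N] and two in
   [M]. *)
- exists 0 => c c0; exists (86 * (2 * c + 12)), 3%N => C d C01 d0 eC ndC K P K1 cP.
  have K0 : (0 < K)%N by exact: ltnW.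
  have P01 i : (i < K)%N -> P i `[(0:R), 1]%classic = 1%E by move=> /cP/C01.
  have up i : (i < K)%N -> d < Eone (P i) (fun x => Num.max (x - Phi C) 0).
    by move=> /cP; exact: easyP.
  have low i j : (i < K)%N -> (j < K)%N ->
      d <= Eone (P i) (fun x => Num.max (mean (P j) - x) 0) by exact: ndC.
  have mphi i : (i < K)%N -> mean (P i) <= Phi C by move=> /cP; exact: mean_le_Phi.
  have phi0 : 0 <= Phi C := Phi_ge0 C01 (cP 0%N K0).
  (* Easiness gives d < Pr[mu > Phi] <= 1. *)
  have d1 : d < 1.
    apply: lt_le_trans (above_gt P01 phi0 up K0) _.
    rewrite -(Exp_cst (P 0%N) 1).
    apply: (Exp_le (measurable_itv _) (P01 _ K0) (bmeas_above _) (bmeas_cst _ _)) => x _.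
    by rewrite /above; case: ifP.
  have [N [M [n0 [[N0 n0N Nd AN] hn hM hT]]]] := round_count c0 d0 d1 K1.
  have NN : N_TS c K P <= N%:R.
    by apply: le_trans AN; apply: (@N_TS_le R K P (Phi C) d) => // i iK; exact: low.
  have [alg [h1 h2 h3]] := easy_algorithm K1 d0 (ltW d1) phi0 P01 mphi up low N0 n0N Nd NN hn hM.
  by exists (N * (K * M.+1))%N, alg.
- move=> d d0; exists (d ^+ 2 / 16); split; first by rewrite divr_gt0// exprn_gt0.
  by move=> C C01 hC; exact: hard_large_L.
- by move=> C; exact: easy_or_hard.
Qed.
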